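(* Let $G$ be a discrete group, let $x\in\partial_F G$ be a point of the Furstenberg boundary of $G$, and let $G_x=\{g\in G: gx=x\}$ be its stabilizer. Then: (1) every maximal ideal of $C^*_r(G)$ is induced from a maximal ideal of $C^*(G_x)$, i.e. for every maximal ideal $J$ of $C^*_r(G)$ there is a maximal ideal $I$ of $C^*(G_x)$ with $J=\mathrm{Ind}_{G_x}(I)$; (2) the map $I\mapsto\mathrm{Ind}_{G_x}(I)$ gives a bijection between the set of maximal co-induced ideals of $C^*(G_x)$ and the set of maximal ideals of $C^*_r(G)$.
   Context: ''Ideal'' of a C*-algebra means closed two-sided ideal; ''maximal ideal'' means maximal among proper ideals. The Furstenberg boundary $\partial_F G$ is the universal minimal strongly proximal compact Hausdorff $G$-space. It is known that $G_x$ is amenable for every $x\in\partial_F G$, so $C^*(G_x)$ is identified with the reduced group C*-algebra $C^*_r(G_x)$. For a subgroup $H\le G$, regard $C^*_r(H)\subseteq C^*_r(G)$ as generated by $\{\lambda_h\}_{h\in H}$, and let $P_H\colon C^*_r(G)\to C^*_r(H)$ be the canonical conditional expectation, determined by $P_H(\lambda_g)=\lambda_g$ if $g\in H$ and $P_H(\lambda_g)=0$ otherwise. For an ideal $I$ of $C^*_r(H)$, $\mathrm{Ind}_H(I)=\{b\in C^*_r(G):P_H(xby)\in I\text{ for all }x,y\in C^*_r(G)\}$ is the ideal of $C^*_r(G)$ induced from $I$. For an ideal $J$ of $C^*_r(G)$, $\mathrm{Coind}_H(J)=\overline{P_H(J)}$ is the ideal of $C^*_r(H)$ co-induced from $J$.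 An ideal of $C^*_r(H)$ is co-induced if it equals $\mathrm{Coind}_H(J)$ for some ideal $J$ of $C^*_r(G)$; a maximal co-induced ideal is a proper co-induced ideal that is maximal among proper co-induced ideals. *)

(* Defs.v *)
From HB Require Import structures.
From mathcomp Require Import all_boot all_order all_algebra.
From mathcomp Require Import all_classical all_reals all_analysis.
From mathcomp Require Import complex.
From mathcomp Require Import ring lra.

Set Implicit Arguments.
Unset Strict Implicit.
Unset Printing Implicit Defensive.
Import Order.TTheory GRing.Theory Num.Theory.
Import numFieldNormedType.Exports.
Local Open Scope classical_set_scope.
Local Open Scope ring_scope.

(* [normc z : R] is the modulus of [z : R[i]], whereas [`|z|] lives in [R[i]]. *)
Local Notation normc := ComplexField.Normc.normc.

Section SquareSummable.
Variables (R : realType) (I : choiceType).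
Implicit Types f g : I -> R[i].

Definition sqnorm f : \bar R := (\esum_(i in [set: I]) (normc (f i) ^+ 2)%:E)%R.

Definition square_summable : {pred I -> R[i]} :=
  [pred f | `[< (sqnorm f < +oo)%E >]].

Lemma square_summableP f : reflect (sqnorm f < +oo)%E (f \in square_summable).
Proof. exact: asboolP. Qed.

Lemma normc_ge0 (z : R[i]) : 0 <= normc z.
Proof. by case: z => a b; rewrite /= sqrtr_ge0. Qed.

Lemma normcD_sqr (z w : R[i]) :
  normc (z + w) ^+ 2 <= 2 * normc z ^+ 2 + 2 * normc w ^+ 2.
Proof.
have := @le_normcD R z w; have := normc_ge0 (z + w).
move: (normc (z + w)) (normc z) (normc w) => u v t u0 uvt.
have := sqr_ge0 (v - t); nra.
Qed.

Lemma sqnorm_ge0 f : (0 <= sqnorm f)%E.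
Proof. by apply: esum_ge0 => i _; rewrite lee_fin sqr_ge0. Qed.

Lemma esumZ_le (D : set I) (k : R) (u : I -> \bar R) :
  0 <= k -> (forall i, (0 <= u i)%E) ->
  (\esum_(i in D) (k%:E * u i)%E <= k%:E * \esum_(i in D) u i)%E.
Proof.
move=> k0 u0; apply: ge_ereal_sup => _ [A [finA AD] <-].
rewrite -ge0_mule_fsumr//.
apply: lee_pmul; rewrite ?lee_fin//; first exact: fsume_ge0.
by apply: ereal_sup_ubound; exists A.
Qed.

Lemma sqnormZ_le (c : R[i]) f :
  (sqnorm (c *: f) <= (normc c ^+ 2)%:E * sqnorm f)%E.
Proof.
apply: le_trans (esumZ_le _ (sqr_ge0 _) _); last first.
  by move=> i; rewrite lee_fin sqr_ge0.
apply: le_esum => i _.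
by rewrite ComplexField.Normc.normcM exprMn EFinM.
Qed.

Lemma square_summable_submod : subsemimod_closed square_summable.
Proof.
have ssZ c f : f \in square_summable -> c *: f \in square_summable.
  move=> /square_summableP f2; apply/square_summableP.
  apply: le_lt_trans (sqnormZ_le c f) _.
  have : sqnorm f \is a fin_num by rewrite ge0_fin_numE ?sqnorm_ge0.
  by move=> /fineK <-; rewrite -EFinM ltry.
split=> //; split.
- apply/square_summableP; rewrite /sqnorm esum1 ?ltry// => i _.
  by rewrite ComplexField.Normc.normc0 expr0n.
- move=> f g /(ssZ 2) /square_summableP f2 /(ssZ 2) /square_summableP g2.
  apply/square_summableP; apply: le_lt_trans (lte_add_pinfty f2 g2).
  rewrite /sqnorm -esumD; [|by move=> i _; rewrite lee_fin sqr_ge0..].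
  apply: le_esum => i _; rewrite -EFinD lee_fin.
  apply: le_trans (normcD_sqr _ _) _.
  have n2 : normc (2 : R[i]) = 2.
    by rewrite (@normcMn R 1 2) ComplexField.Normc.normc1.
  rewrite !ComplexField.Normc.normcM n2 !exprMn.
  have := sqr_ge0 (normc (f i)); have := sqr_ge0 (normc (g i)); lra.
Qed.

HB.instance Definition _ := GRing.isSubmodClosed.Build _ _ square_summable
  square_summable_submod.

Definition ell2 := {f : I -> R[i] | f \in square_summable}.
HB.instance Definition _ := SubChoice.on ell2.
HB.instance Definition _ := [SubChoice_isSubLmodule of ell2 by <:].

Definition ell2_norm (xi : ell2) : R := Num.sqrt (fine (sqnorm (val xi))).
End SquareSummable.
Arguments ell2 : clear implicits.

Section ReducedGroupAlgebra.
Variables (R : realType) (G : groupType).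
Local Notation op := (ell2 R G -> ell2 R G).
Implicit Types (H : set G) (S A I J K : set op) (a b : op).

Lemma translate_square_summable (g : G) (xi : ell2 R G) :
  (fun t : G => val xi (g^-1 * t)%g) \in @square_summable R G.
Proof.
apply/square_summableP; move/square_summableP: (valP xi); congr (_ < _)%E.
rewrite /sqnorm (@reindex_esum _ _ _ setT setT (fun t : G => g^-1 * t)%g)//.
split=> //.
- by move=> s t _ _; exact: mulgI.
- by move=> t _; exists (g * t)%g => //; rewrite mulKg.
Qed.

(* left regular representation: [(lambda g xi) t = xi (g^-1 t)] *)
Definition lambda (g : G) : op :=
  fun xi => exist (fun f : G -> R[i] => f \in @square_summable R G)
    (fun t => val xi (g^-1 * t)%g) (translate_square_summable g xi).

(* [op_norm_le a M] is [||a|| <= M]. *)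
Definition op_norm_le a (M : R) : Prop :=
  forall xi, ell2_norm (a xi) <= M * ell2_norm xi.

(* The ambient type [op] also contains nonlinear and unbounded maps, but the
   operator-norm closure of a set of bounded operators only contains bounded
   operators. *)
Definition norm_closure S : set op :=
  [set a | forall e : R, 0 < e -> exists2 b, S b & op_norm_le (a - b) e].

Definition group_algebra H : set op :=
  [set a : op | exists (s : seq G) (c : G -> R[i]),
     {in s, forall h, H h} /\ a = \sum_(h <- s) c h *: lambda h].

(* For a subgroup H, this is the C*-algebra generated by the [lambda h], h in H,
   inside B(ell2 G), since [group_algebra H] is then a *-algebra. *)
Definition cstar_r H : set op := norm_closure (group_algebra H).

Definition ideal A I : Prop :=
  [/\ I `<=` A,
      I 0,
      forall (c : R[i]) a b, I a -> I b -> I (c *: a + b),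
      forall a b, A a -> I b -> I (a \o b) /\ I (b \o a)
    & norm_closure I `<=` I].

Definition maximal_proper A (F : set (set op)) : set (set op) :=
  [set I | [/\ F I, I <> A & forall K, F K -> K <> A -> I `<=` K -> K = I]].

Definition maximal_ideal A : set (set op) := maximal_proper A (ideal A).

Definition is_cond_exp H (P : op -> op) : Prop :=
  [/\ forall a, cstar_r setT a -> cstar_r H (P a),
      forall (c : R[i]) a b, cstar_r setT a -> cstar_r setT b ->
        P (c *: a + b) = c *: P a + P b,
      forall a M, cstar_r setT a -> op_norm_le a M -> op_norm_le (P a) M,
      forall b, cstar_r H b -> P b = b
    & forall g, (H g -> P (lambda g) = lambda g) /\
                (~ H g -> P (lambda g) = 0)].

(* On [cstar_r setT] the conditions [is_cond_exp H] determine [P]; outside of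
   that algebra, the values of [cond_exp H] are irrelevant. Existence is
   [cond_expP] below. *)
Definition cond_exp H : op -> op :=
  xget (0 : op -> op) [set P | is_cond_exp H P].

Definition Ind H I : set op :=
  [set b | cstar_r setT b /\
     forall x y, cstar_r setT x -> cstar_r setT y ->
       I (cond_exp H (x \o b \o y))].

Definition Coind H J : set op := norm_closure (cond_exp H @` J).

Definition coinduced_ideal H : set (set op) :=
  [set I | ideal (cstar_r H) I /\
     exists2 J, ideal (cstar_r setT) J & I = Coind H J].

Definition maximal_coinduced_ideal H : set (set op) :=
  maximal_proper (cstar_r H) (coinduced_ideal H).
End ReducedGroupAlgebra.
Arguments cstar_r R {G} H.
Arguments maximal_coinduced_ideal R {G} H.

Section CondExp.
Variables (R : realType) (G : groupType).
Local Notation op := (ell2 R G -> ell2 R G).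
Implicit Types (H : set G) (a b : op) (xi eta : ell2 R G).

Lemma sqnorm_fin xi : (sqnorm (val xi) \is a fin_num)%E.
Proof. by rewrite ge0_fin_numE ?sqnorm_ge0//; exact/square_summableP/valP. Qed.

Lemma sqnorm_eq0 (f : G -> R[i]) : (sqnorm f <= 0)%E -> f = 0.
Proof.
move=> f0; apply/funext => t.
apply: ComplexField.Normc.eq0_normc; apply/eqP; rewrite -sqrf_eq0 eq_le sqr_ge0 andbT.
rewrite -lee_fin; apply: le_trans f0.
apply: esum_ge; exists [set t]; first by split.
by rewrite fsbig_set1.
Qed.

Lemma sqnormD_le (f g : G -> R[i]) :
  (sqnorm (f + g)%R <= 2%:E * sqnorm f + 2%:E * sqnorm g)%E.
Proof.
apply: (@le_trans _ _ (\esum_(i in [set: G])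
    (2%:E * (normc (f i) ^+ 2)%:E + 2%:E * (normc (g i) ^+ 2)%:E)%E)%R).
  by apply: le_esum => i _; rewrite -!EFinM -EFinD lee_fin normcD_sqr.
have sq0 (h : G -> R[i]) i : (0 <= (normc (h i) ^+ 2)%:E)%E.
  by rewrite lee_fin sqr_ge0.
rewrite esumD; [|by move=> i _; rewrite mule_ge0// lee_fin..].
by apply: leeD; apply: esumZ_le.
Qed.

Definition sq_bounded a (K : R) :=
  forall xi, (sqnorm (val (a xi)) <= K%:E * sqnorm (val xi))%E.

Lemma op_norm_leP a (M : R) : 0 <= M ->
  op_norm_le a M <-> sq_bounded a (M ^+ 2).
Proof.
move=> M0.
have E xi : (ell2_norm (a xi) <= M * ell2_norm xi) =
    (sqnorm (val (a xi)) <= (M ^+ 2)%:E * sqnorm (val xi))%E.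
  rewrite /ell2_norm -(fineK (sqnorm_fin (a xi))) -(fineK (sqnorm_fin xi)).
  rewrite -EFinM lee_fin /=.
  rewrite -[M in LHS]ger0_norm// -sqrtr_sqr -sqrtrM ?sqr_ge0// ler_sqrt//.
  by rewrite mulr_ge0 ?sqr_ge0// fine_ge0// sqnorm_ge0.
by split=> h xi; [rewrite -E|rewrite E].
Qed.

Lemma op_norm_le_neg a (M : R) : M < 0 -> op_norm_le a M ->
  forall b, op_norm_le b M.
Proof.
move=> M0 aM b xi.
have n0 eta : ell2_norm eta = 0.
  have := aM eta; have := sqrtr_ge0 (fine (sqnorm (val (a eta)))).
  have := sqrtr_ge0 (fine (sqnorm (val eta))).
  rewrite -/(ell2_norm _) -/(ell2_norm _) => p q r; apply/eqP.
  by rewrite eq_le p andbT -(@nmulr_rge0 _ M)// (le_trans q).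
by rewrite !n0 mulr0.
Qed.

Definition bounded_op a := exists2 K : R, 0 <= K & sq_bounded a K.

Lemma sqnorm_translate (g : G) xi : sqnorm (val (lambda g xi)) = sqnorm (val xi).
Proof.
rewrite [RHS](@reindex_esum _ _ _ setT setT (fun t : G => g^-1 * t)%g)//.
split=> //.
- by move=> s t _ _; exact: mulgI.
- by move=> t _; exists (g * t)%g => //; rewrite mulKg.
Qed.

Lemma bounded_lambda g : bounded_op (lambda g).
Proof. by exists 1 => // xi; rewrite sqnorm_translate mul1e. Qed.

Lemma val0 : val (0 : ell2 R G) = 0. Proof. exact: raddf0. Qed.

Lemma bounded0 : bounded_op 0.
Proof.
exists 0 => // xi; rewrite mul0e val0 /sqnorm esum1// => i _.
by rewrite ComplexField.Normc.normc0 expr0n.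
Qed.

Lemma boundedD a b : bounded_op a -> bounded_op b -> bounded_op (a + b).
Proof.
move=> [K K0 aK] [L L0 bL]; exists (2 * K + 2 * L).
  by rewrite addr_ge0// mulr_ge0.
move=> xi; have -> : val ((a + b) xi) = val (a xi) + val (b xi).
  exact: raddfD.
apply: le_trans (sqnormD_le _ _) _.
rewrite (EFinD (2 * K)) ge0_muleDl ?lee_fin ?mulr_ge0// !EFinM -!muleA.
by apply: leeD; (apply: lee_wpmul2l; first by rewrite lee_fin); [exact: aK|exact: bL].
Qed.

Lemma boundedZ (c : R[i]) a : bounded_op a -> bounded_op (c *: a).
Proof.
move=> [K K0 aK]; exists (normc c ^+ 2 * K); first by rewrite mulr_ge0 ?sqr_ge0.
move=> xi; have -> : val ((c *: a) xi) = c *: val (a xi) by [].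
apply: le_trans (sqnormZ_le _ _) _.
rewrite (EFinM (normc c ^+ 2)) -muleA.
by apply: lee_wpmul2l; [rewrite lee_fin sqr_ge0|exact: aK].
Qed.

Lemma group_algebra_bounded H a : group_algebra H a -> bounded_op a.
Proof.
move=> [s [c [_ ->]]]; elim/big_ind: _ => //; first exact: bounded0.
  exact: boundedD.
by move=> h _; apply/boundedZ/bounded_lambda.
Qed.

Lemma cstar_r_bounded H a : cstar_r R H a -> bounded_op a.
Proof.
move=> /(_ 1 ltr01) [b /group_algebra_bounded bb /op_norm_leP].
rewrite expr1n => /(_ ler01) ab1.
rewrite -(subrK b a); apply: boundedD => //.
by exists 1.
Qed.

Variable H : set G.
Hypotheses (H1 : H 1%g) (HM : forall g h, H g -> H h -> H (g * h)%g)
  (HV : forall g, H g -> H g^-1%g).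

Let coset (s : G) : set G := [set t | H (t * s^-1)%g].
Let r (s : G) : G := xget 1%g (coset s).

Let coset_r s : coset s (r s).
Proof. by apply: (@xgetI _ _ _ s); rewrite /coset/= mulgV. Qed.

Let rE s t : (r s = r t) <-> H (s * t^-1)%g.
Proof.
split=> [E|Hst].
  have := coset_r t; rewrite -E /coset/= => Ht.
  have /HV := coset_r s; rewrite /coset /= invgM invgK => Hs.
  by have := HM Hs Ht; rewrite mulgA mulgVK.
rewrite /r; congr (xget _ _); apply/seteqP; split=> u; rewrite /coset /= => Hu.
  by have := HM Hu Hst; rewrite mulgA mulgVK.
by have := HM Hu (HV Hst); rewrite invgM invgK mulgA mulgVK.
Qed.

Let fib (c : G) : set G := [set t | r t = c].

Lemma esum_fib (u : G -> \bar R) : (forall s, (0 <= u s)%E) ->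
  (\esum_(s in [set: G]) u s = \esum_(c in [set: G]) \esum_(s in fib c) u s)%R.
Proof.
move=> u0; rewrite (@esum_esum _ _ _ setT fib (fun=> u))//.
rewrite (@reindex_esum _ _ _ setT _ (fun s => (r s, s)) (fun k => u k.2))//.
split.
- by move=> s _.
- by move=> s t _ _ [].
- by move=> [c s] [_ /= <-]; exists s.
Qed.

Definition cut_fun (A : set G) (f : G -> R[i]) : G -> R[i] :=
  fun t => if t \in A then f t else 0.

Lemma sqnorm_cut A f :
  sqnorm (cut_fun A f) = (\esum_(t in A) (normc (f t) ^+ 2)%:E)%R.
Proof.
rewrite [RHS]esum_mkcond; apply: eq_esum => t _; rewrite /cut_fun.
by case: ifP => // _; rewrite ComplexField.Normc.normc0 expr0n.
Qed.

Lemma sqnorm_cut_le A f : (sqnorm (cut_fun A f) <= sqnorm f)%E.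
Proof.
apply: le_esum => t _; rewrite lee_fin /cut_fun; case: ifP => // _.
by rewrite ComplexField.Normc.normc0 expr0n sqr_ge0.
Qed.

Lemma cut_summable A xi : cut_fun A (val xi) \in @square_summable R G.
Proof.
apply/square_summableP; apply: le_lt_trans (sqnorm_cut_le _ _) _.
exact/square_summableP/valP.
Qed.

Definition cut A xi : ell2 R G :=
  exist (fun f : G -> R[i] => f \in @square_summable R G) _ (cut_summable A xi).

Definition diag_fun a xi : G -> R[i] :=
  fun s => val (a (cut (fib (r s)) xi)) s.

Lemma sqnorm_diag a K xi : 0 <= K -> sq_bounded a K ->
  (sqnorm (diag_fun a xi) <= K%:E * sqnorm (val xi))%E.
Proof.
move=> K0 aK.
have sq0 (h : G -> R[i]) i : (0 <= (normc (h i) ^+ 2)%:E)%E.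
  by rewrite lee_fin sqr_ge0.
rewrite /sqnorm [leLHS]esum_fib// [in leRHS]esum_fib//.
apply: le_trans (esumZ_le _ K0 _); last by move=> c; apply: esum_ge0.
apply: le_esum => c _.
rewrite -[leRHS]/(K%:E * _)%E -(sqnorm_cut (fib c) (val xi)).
apply: le_trans (aK (cut (fib c) xi)).
apply: le_trans (sqnorm_cut_le (fib c) _).
rewrite sqnorm_cut; apply: le_esum => s; rewrite /fib /= => sc.
by rewrite /diag_fun sc.
Qed.

(* For [a] in [cstar_r R setT], this is the conditional expectation: it keeps the
   matrix entries [(s, t)] of [a] such that [s] and [t] lie in the same coset
   of H. *)
Definition diag a : op := fun xi => insubd 0 (diag_fun a xi).

Lemma diagE a : bounded_op a -> forall xi, val (diag a xi) = diag_fun a xi.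
Proof.
move=> [K K0 aK] xi; rewrite /diag insubdK//; apply/square_summableP.
apply: le_lt_trans (sqnorm_diag xi K0 aK) _.
by rewrite -(fineK (sqnorm_fin xi)) -EFinM ltry.
Qed.

Lemma diag_sq_bounded a K : 0 <= K -> sq_bounded a K -> sq_bounded (diag a) K.
Proof.
by move=> K0 aK xi; rewrite diagE; [exact: sqnorm_diag|exists K].
Qed.

Lemma diagP c a b : bounded_op a -> bounded_op b ->
  diag (c *: a + b) = c *: diag a + diag b.
Proof.
move=> ba bb; apply/funext => xi; apply/val_inj.
rewrite diagE; last by apply: boundedD => //; exact: boundedZ.
rewrite -[RHS]/(c *: val (diag a xi) + val (diag b xi)).
by rewrite !diagE//.
Qed.

Lemma diag_lambda g :
  (H g -> diag (lambda g) = lambda g) /\ (~ H g -> diag (lambda g) = 0).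
Proof.
have E xi s : diag_fun (lambda g) xi s = if `[< H g >] then val xi (g^-1 * s)%g else 0.
  rewrite /diag_fun /= /cut_fun; congr (if _ then _ else _).
  apply: asbool_equiv_eq; rewrite /fib /=; split.
    by move=> /esym/rE; rewrite invgM invgK mulgA mulgV mul1g.
  by move=> Hg; apply/esym/rE; rewrite invgM invgK mulgA mulgV mul1g.
split=> Hg; apply/funext => xi; apply/val_inj; rewrite diagE.
- by apply/funext => s; rewrite E asboolT.
- exact: bounded_lambda.
- by apply/funext => s; rewrite E asboolF.
- exact: bounded_lambda.
Qed.

Lemma diag0 : diag 0 = 0.
Proof. by apply/funext => xi; apply/val_inj; rewrite diagE//; exact: bounded0. Qed.

Lemma diag_sum (s : seq G) (c : G -> R[i]) :
  diag (\sum_(h <- s) c h *: lambda h) = \sum_(h <- s) c h *: diag (lambda h).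
Proof.
elim: s => [|h s IH]; first by rewrite !big_nil diag0.
rewrite !big_cons diagP ?IH//; first exact: bounded_lambda.
apply: (@group_algebra_bounded setT); exists s, c; split=> //.
Qed.

Lemma diag_group_algebra a : group_algebra setT a -> group_algebra H (diag a).
Proof.
move=> [s [c [_ ->]]]; exists [seq h <- s | `[< H h >]], c; split.
  by move=> h; rewrite mem_filter => /andP[/asboolP].
rewrite diag_sum big_filter [RHS]big_mkcond/=; apply: eq_bigr => h _.
case: asboolP => Hh; first by rewrite (diag_lambda h).1.
by rewrite (diag_lambda h).2// scaler0.
Qed.

Lemma group_algebra_sub a : group_algebra H a -> group_algebra setT a.
Proof. by move=> [s [c [_ ->]]]; exists s, c. Qed.

Lemma diag_group_algebra_id a : group_algebra H a -> diag a = a.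
Proof.
move=> [s [c [sH ->]]]; rewrite diag_sum.
by rewrite big_seq [RHS]big_seq; apply: eq_bigr => h /sH /(diag_lambda h).1 ->.
Qed.

Lemma diag_op_norm a M : bounded_op a -> op_norm_le a M -> op_norm_le (diag a) M.
Proof.
move=> ba aM; have [M0|M0] := leP 0 M; last exact: op_norm_le_neg M0 aM _.
by apply/op_norm_leP => //; apply: diag_sq_bounded; [exact: sqr_ge0|exact/op_norm_leP].
Qed.

Lemma diagB a b : bounded_op a -> bounded_op b -> diag (a - b) = diag a - diag b.
Proof.
move=> ba bb; rewrite addrC -scaleN1r diagP// scaleN1r addrC//.
Qed.

Lemma is_cond_exp_diag : is_cond_exp H diag.
Proof.
split.
- move=> a aA e e0; have [b bA abe] := aA e e0.
  exists (diag b); first exact: diag_group_algebra.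
  have ba := cstar_r_bounded aA; have bb := group_algebra_bounded bA.
  rewrite -diagB//; apply: diag_op_norm => //; rewrite -scaleN1r.
  by apply: boundedD => //; exact: boundedZ.
- by move=> c a b /cstar_r_bounded ? /cstar_r_bounded ?; exact: diagP.
- by move=> a M /cstar_r_bounded; exact: diag_op_norm.
- move=> a aH; have ba := cstar_r_bounded aH.
  apply/funext => xi; apply/eqP; rewrite -subr_eq0; apply/eqP/val_inj.
  rewrite val0; apply: sqnorm_eq0; apply/lee_addgt0Pr => e e0; rewrite add0e.
  set n := fine (sqnorm (val xi)).
  have n0 : 0 <= n by rewrite fine_ge0// sqnorm_ge0.
  pose d := Num.sqrt (e / (4 * (n + 1))).
  have n1 : 0 < 4 * (n + 1) by lra.
  have d0 : 0 < d by rewrite sqrtr_gt0 divr_gt0.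
  have d2 : d ^+ 2 = e / (4 * (n + 1)) by rewrite sqr_sqrtr// divr_ge0 ?ltW.
  have [b bH abd] := aH d d0.
  have bb := group_algebra_bounded bH.
  have bab : bounded_op (a - b).
    by rewrite -scaleN1r; apply: boundedD => //; exact: boundedZ.
  have {}abd := (op_norm_leP (a - b) (ltW d0)).1 abd.
  have dabd := diag_sq_bounded (sqr_ge0 d) abd.
  have -> : val (diag a xi - a xi) =
      val (diag (a - b) xi) + (- 1) *: val ((a - b) xi).
    rewrite -[RHS]/(val (diag (a - b) xi + (- 1) *: (a - b) xi)); congr val.
    rewrite diagB// (diag_group_algebra_id bH) scaleN1r.
    rewrite -[(diag a - b) xi]/(diag a xi - b xi) -[(a - b) xi]/(a xi - b xi).
    by rewrite opprB addrA subrK.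
  apply: le_trans (sqnormD_le _ _) _.
  have m1 : normc (- 1 : R[i]) = 1.
    by rewrite normcN ComplexField.Normc.normc1.
  have h1 := dabd xi; have h2 := le_trans (sqnormZ_le (- 1) (val ((a - b) xi))) (lee_wpmul2l _ (abd xi)).
  have {}h2 : (sqnorm ((-1) *: val ((a - b) xi))%R <= (d ^+ 2)%:E * sqnorm (val xi))%E.
    by move: h2; rewrite m1 expr1n !mul1e; apply; rewrite lee_fin.
  apply: (@le_trans _ _ (2%:E * ((d ^+ 2)%:E * n%:E) + 2%:E * ((d ^+ 2)%:E * n%:E))%E).
    rewrite /n (fineK (sqnorm_fin xi)).
    by apply: leeD; (apply: lee_wpmul2l; first by rewrite lee_fin).
  rewrite -!EFinM -EFinD lee_fin d2.
  rewrite (_ : _ + _ = e * (n / (n + 1))); last by field; apply/eqP; lra.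
  apply: ler_piMr; first exact: ltW.
  by rewrite ler_pdivrMr ?mul1r; lra.
- exact: diag_lambda.
Qed.

Lemma cond_expP : is_cond_exp H (@cond_exp R G H).
Proof. by apply: (@xgetI _ _ _ diag); exact: is_cond_exp_diag. Qed.
End CondExp.

(* A [ptopologicalType] has a distinguished point, which only encodes that the
   space is nonempty. *)
Section Boundary.
Variables (R : realType) (G : groupType).

Definition is_action (X : ptopologicalType) (act : G -> X -> X) : Prop :=
  [/\ forall x, act 1%g x = x,
      forall g h x, act (g * h)%g x = act g (act h x)
    & forall g, continuous (act g)].

Definition minimal_action (X : ptopologicalType) (act : G -> X -> X) : Prop :=
  forall A : set X, closed A -> A !=set0 ->
    (forall g, act g @` A `<=` A) -> A = setT.

Definition borel (X : ptopologicalType) := g_sigma_algebraType (@open X).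

(* On a compact Hausdorff space, closed and compact subsets coincide. *)
Definition regular_measure (X : ptopologicalType)
    (mu : set (borel X) -> \bar R) : Prop :=
  forall A : set (borel X), measurable A ->
    mu A = ereal_sup [set mu K | K in [set K : set X | compact K /\ K `<=` A]].

(* The weak* topology on measures is the pointwise topology on the functionals
   [integral_functional nu]. *)
Definition integral_functional (X : ptopologicalType) (nu : set (borel X) -> \bar R) :
    {ptws continuousType X R -> R} :=
  fun f => fine (\int[nu]_y (f y)%:E)%E.

Definition strongly_proximal (X : ptopologicalType) (act : G -> X -> X) : Prop :=
  forall mu : probability (borel X) R, regular_measure mu ->
    exists z : X,
      closure
        [set integral_functional (pushforward mu (act g : borel X -> borel X))
        | g in [set: G]]
        (integral_functional (dirac (z : borel X))).

Definition boundary (X : ptopologicalType) (act : G -> X -> X) : Prop :=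
  [/\ compact [set: X], hausdorff_space X, is_action act, minimal_action act
    & strongly_proximal act].

Definition furstenberg_boundary (X : ptopologicalType) (act : G -> X -> X) :=
  boundary act /\
  forall (Y : ptopologicalType) (actY : G -> Y -> Y), boundary actY ->
    exists f : X -> Y, continuous f /\ forall g x, f (act g x) = actY g (f x).

Definition stabilizer (X : Type) (act : G -> X -> X) (x : X) : set G :=
  [set g | act g x = x].
End Boundary.

(* Main.v *)
Require Import Defs.
From HB Require Import structures.
From mathcomp Require Import all_boot all_order all_algebra.
From mathcomp Require Import all_classical all_reals all_analysis.
From mathcomp Require Import complex finmap measurable_realfun.
From mathcomp Require Import ring lra.
Local Open Scope classical_set_scope.

Set Implicit Arguments.
Unset Strict Implicit.
Unset Printing Implicit Defensive.
Import Order.TTheory GRing.Theory Num.Theory.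
Import numFieldNormedType.Exports.
Local Open Scope ring_scope.

(** Write [A] for the reduced C*-algebra of [G], [B] for that of the stabilizer
    [H] of the point, and [P] for the conditional expectation from [A] onto [B].

    Most of the statement is formal.  Induction and co-induction form a Galois
    connection, [J `<=` Ind H I] iff [Coind H J `<=` I] ([sub_IndP]), and
    induction keeps proper ideals proper, because [P id = id].  Suppose that
    co-induction keeps them proper as well ([Coind_proper]).  If [J] is a
    maximal ideal of [A], then [Coind H J] lies in a maximal ideal [I] of [B];
    hence [J `<=` Ind H I], and maximality of [J] makes this an equality
    ([maximal_ideal_induced]).  On co-induced ideals [Coind H] is a left inverse
    of [Ind H], which turns the same comparison of maximal elements into the
    bijection ([Ind_maximal_bij]).

    The content is therefore [Coind_proper], the place where strong proximality
    enters.  The usual reason is the following: a state of [A] that vanishes on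
    [J] extends to the crossed product of C(X) by [G]; translates of its
    restriction to C(X) accumulate at the point mass at [x]; the corresponding
    limit state vanishes on [J] and factors through [P], so that it separates
    the identity from [P @` J].  The argument below is a quantitative form of it,
    in which a coercive element of [J] takes the place of the states.  If [id] is in [Coind H J], then
    some [j] in [J] has [P j] close to [id], and some finite combination [a] of
    translations is close to [j].  The finitely many elements of the support of
    [a] that move [x] also move a small neighbourhood [U] of [x] off itself, so
    the compression of [a] to the vectors supported on the [t] with [t x] in [U]
    equals that of [P a], which is close to [id].  Consequently [a] is bounded
    below on vectors that are mostly supported there
    ([compression_lower_bound]).  Every vector becomes such a vector on average:
    some finite positive combination of translates of the indicator of [U] is
    nearly constant on X ([covering_combination]).  Averaging the conjugates of
    (adjoint of [a]) [j] by the translations with these weights gives a coercive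
    element of [J], a multiple of which is at distance less than 1 from the
    identity ([coercive_near_id]); a Neumann series then yields [J = A]
    ([ideal_neumann]).

    [covering_combination] is a minimax statement.  If it fails, the Hahn-Banach
    theorem ([hahn_banach]) gives a positive normalized functional that is at
    most [c] on all translates of a function [f] with [c < f x].  By the
    Riesz-Markov theorem ([riesz_markov]) it is a regular probability measure,
    some translates of which approach a point mass; minimality moves that point
    to where [f] exceeds [c], a contradiction ([proximal_functional]). *)

(** * The Hahn-Banach theorem *)

Section HahnBanach.
Variables (R : realType) (V : lmodType R).
Implicit Types (p q : V -> R).

Definition sublinear q : Prop :=
  (forall x y, q (x + y) <= q x + q y) /\
  (forall a x, 0 <= a -> q (a *: x) <= a * q x).

Lemma sublinear0 q : sublinear q -> q 0 = 0.
Proof.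
move=> [qD qZ]; have := qD 0 0; have := qZ 0 0 (lexx 0).
by rewrite scale0r mul0r addr0 => ? ?; apply/eqP; rewrite eq_le; lra.
Qed.

Lemma sublinearN_ge q x : sublinear q -> - q (- x) <= q x.
Proof.
by move=> qs; have := qs.1 x (- x); rewrite subrr (sublinear0 qs); lra.
Qed.

Lemma sublinear_odd_linear q : sublinear q -> (forall x, q (- x) <= - q x) ->
  forall a x y, q (a *: x + y) = a * q x + q y.
Proof.
move=> [qD qZ] qodd.
have qN x : q (- x) = - q x.
  apply/eqP; rewrite eq_le qodd/=.
  by have := qD x (- x); rewrite subrr (sublinear0 (conj qD qZ)); lra.
have addq x y : q (x + y) = q x + q y.
  apply/eqP; rewrite eq_le qD/=; have := qD (- x) (- y).
  by rewrite -opprD !qN; lra.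
have posq a x : 0 <= a -> q (a *: x) = a * q x.
  move=> a0; apply/eqP; rewrite eq_le qZ//=; have := qZ a (- x) a0.
  by rewrite scalerN !qN; lra.
move=> a x y; rewrite addq; congr (_ + _).
have [a0|a0] := leP 0 a; first exact: posq.
have /(posq _ x) : 0 <= - a by lra.
by rewrite scaleNr qN => /eqP; rewrite mulNr eqr_opp => /eqP.
Qed.

(** The functional [r x := inf_(t >= 0) (q (x + t y) - t q y)] is again sublinear
    and lies below [q].  A minimal [q] equals all of its tilts, hence is odd, and
    an odd sublinear functional is linear. *)
Lemma sublinear_tilt q y : sublinear q ->
  exists r, [/\ sublinear r, (forall x, r x <= q x) & r (- y) <= - q y].
Proof.
move=> qs; have [qD qZ] := qs.
pose S x := [set q (x + t *: y) - t * q y | t in [set t : R | 0 <= t]].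
have lbS x : lbound (S x) (- q (- x)).
  move=> _ [t /= t0 <-]; have := qD (x + t *: y) (- x); rewrite addrC addKr.
  have := qD (t *: y) (- (t *: y)); have := qZ _ (- y) t0.
  rewrite subrr (sublinear0 qs) scalerN => h1 h2.
  have := qZ _ y t0; rewrite -subr_ge0 => h3 h4.
  have := sublinearN_ge y qs => h5.
  suff : q (t *: y) >= t * q y by lra.
  move: t0; rewrite le_eqVlt => /predU1P[<-|t0].
    by rewrite scale0r mul0r (sublinear0 qs).
  have /(qZ _ (t *: y)) : 0 <= t^-1 by rewrite invr_ge0 ltW.
  by rewrite scalerA mulVf ?gt_eqF// scale1r mulrC ler_pdivlMr// mulrC.
have hiS x : has_inf (S x).
  split; last by exists (- q (- x)).
  by exists (q (x + 0 *: y) - 0 * q y); exists 0 => //=.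
have rle x t : 0 <= t -> inf (S x) <= q (x + t *: y) - t * q y.
  by move=> t0; apply: ge_inf; [exact: (hiS x).2|exists t].
have r_le_q x : inf (S x) <= q x.
  by have := rle x 0 (lexx 0); rewrite scale0r addr0 mul0r subr0.
exists (fun x => inf (S x)); split => //.
  split.
    move=> x1 x2; apply/ler_addgt0Pr => e e0.
    have e20 : 0 < e / 2 by lra.
    have [_ [t1 /= t10 <-] h1] := inf_adherent e20 (hiS x1).
    have [_ [t2 /= t20 <-] h2] := inf_adherent e20 (hiS x2).
    have := rle (x1 + x2) (t1 + t2) (addr_ge0 t10 t20).
    rewrite scalerDl addrACA; have := qD (x1 + t1 *: y) (x2 + t2 *: y).
    by lra.
  move=> a x; rewrite le_eqVlt => /predU1P[<-|a0].
    by rewrite scale0r mul0r (le_trans (r_le_q _))// (sublinear0 qs).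
  rewrite mulrC -ler_pdivrMr//; apply: lb_le_inf; first exact: (hiS x).1.
  move=> _ [t /= t0 <-]; rewrite ler_pdivrMr//.
  apply: le_trans (rle (a *: x) (a * t) (mulr_ge0 (ltW a0) t0)) _.
  rewrite -scalerA -scalerDr; have := qZ a (x + t *: y) (ltW a0); lra.
have := rle (- y) 1 ler01.
by rewrite scale1r addNr (sublinear0 qs) mul1r sub0r.
Qed.

(** A minimal sublinear functional below [p] exists by Zorn's lemma: the infimum
    over a chain is subadditive because two members of a chain can be replaced by
    the smaller one. *)
Theorem hahn_banach p : sublinear p ->
  exists m : V -> R, (forall a x y, m (a *: x + y) = a * m x + m y) /\
    (forall x, m x <= p x).
Proof.
move=> ps.
pose T := {q : V -> R | `[< sublinear q /\ forall x, q x <= p x >]}.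
pose below (s t : T) := `[< forall x, sval t x <= sval s x >].
pose mkT q (qP : sublinear q /\ forall x, q x <= p x) : T :=
  exist (fun q => `[< sublinear q /\ forall x, q x <= p x >] : Prop) q (asboolT qP).
have TP (s : T) : sublinear (sval s) /\ forall x, sval s x <= p x.
  exact/asboolP/(svalP s).
have [] := @Zorn T below.
- by move=> s; apply/asboolP.
- by move=> r s t /asboolP rs /asboolP st; apply/asboolP => x; exact: le_trans (rs x).
- move=> [s sP] [t tP] /asboolP/= st /asboolP/= ts; apply/eq_exist/funext => x.
  by apply/eqP; rewrite eq_le st ts.
- move=> A Atot; have [[s0 As0]|A0] := pselect (exists s, A s); last first.
    have pp : sublinear p /\ forall x, p x <= p x by split.
    by exists (mkT p pp) => s As; case: A0; exists s.
  pose S x := [set sval s x | s in A].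
  have hiS x : has_inf (S x).
    split; first by exists (sval s0 x); exists s0.
    exists (- p (- x)) => _ [s As <-]; apply: le_trans (sublinearN_ge x (TP s).1).
    by rewrite lerN2 (TP s).2.
  have tle s x : A s -> inf (S x) <= sval s x.
    by move=> As; apply: ge_inf; [exact: (hiS x).2|exists s].
  have tT : sublinear (fun x => inf (S x)) /\ forall x, inf (S x) <= p x.
    split; last first.
      by move=> x; exact: le_trans (tle _ _ As0) ((TP s0).2 x).
    split.
      move=> x1 x2; apply/ler_addgt0Pr => e e0.
      have e20 : 0 < e / 2 by lra.
      have [_ [s1 A1 <-] h1] := inf_adherent e20 (hiS x1).
      have [_ [s2 A2 <-] h2] := inf_adherent e20 (hiS x2).
      have [/asboolP s12|/asboolP s21] := Atot _ _ A1 A2.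
      - have := (TP s2).1.1 x1 x2; have := tle _ (x1 + x2) A2; have := s12 x1; lra.
      - have := (TP s1).1.1 x1 x2; have := tle _ (x1 + x2) A1; have := s21 x2; lra.
    move=> a x; rewrite le_eqVlt => /predU1P[<-|a0].
      by rewrite scale0r mul0r (le_trans (tle _ _ As0))// (sublinear0 (TP s0).1).
    rewrite mulrC -ler_pdivrMr//; apply: lb_le_inf; first exact: (hiS x).1.
    move=> _ [s As <-]; rewrite ler_pdivrMr// mulrC.
    by apply: le_trans (tle _ _ As) _; apply: (TP s).1.2; exact: ltW.
  by exists (mkT _ tT) => s As; apply/asboolP => x; exact: tle.
move=> q qmin; have [qs qp] := TP q.
exists (sval q); split => //; apply: sublinear_odd_linear => // y.
have [r [rs rq ry]] := sublinear_tilt y qs.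
have rT : sublinear r /\ forall x, r x <= p x.
  by split => // x; exact: le_trans (qp x).
have <- : mkT r rT = q by apply: qmin; apply/asboolP.
rewrite [leLHS]/=; apply: le_trans ry _.
by rewrite lerN2; exact: rq.
Qed.
End HahnBanach.

(** * The Riesz-Markov theorem on a compact Hausdorff space *)

Section Riesz.
Variables (R : realType) (X : ptopologicalType).
Hypotheses (cX : compact [set: X]) (hX : hausdorff_space X).
Implicit Types (f g h : X -> R) (U V : set X).

Lemma continuous_lin (a : R) f g : continuous f -> continuous g ->
  continuous (fun x => a * f x + g x).
Proof.
move=> cf cg x; apply: (@cvgD _ R^o); last exact: cg.
by apply: cvgM; [exact: cvg_cst|exact: cf].
Qed.

Lemma continuous_const (c : R) : continuous ((fun=> c) : X -> R).
Proof. by move=> x; exact: cvg_cst. Qed.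

(** A functional on C(X): only its values on continuous functions are meaningful. *)
Definition positive_functional (L : (X -> R) -> R) : Prop :=
  [/\ forall a f g, continuous f -> continuous g ->
        L (fun x => a * f x + g x) = a * L f + L g,
      forall f, continuous f -> (forall x, 0 <= f x) -> 0 <= L f
    & L (fun=> 1) = 1].

Variable L : (X -> R) -> R.
Hypothesis Lpos : positive_functional L.

Let Llin a f g : continuous f -> continuous g ->
  L (fun x => a * f x + g x) = a * L f + L g.
Proof. by have [+ _ _] := Lpos; exact. Qed.

Let L0 : L (fun=> 0) = 0.
Proof.
have := Llin 1 (@continuous_const 0) (@continuous_const 0).
have -> : (fun x : X => 1 * 0 + 0 : R) = fun=> 0.
  by apply/funext => x; rewrite mulr0 addr0.
by lra.
Qed.

Lemma functionalD f g : continuous f -> continuous g ->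
  L (fun x => f x + g x) = L f + L g.
Proof.
move=> cf cg; have := Llin 1 cf cg; rewrite mul1r => <-.
by congr L; apply/funext => x; rewrite mul1r.
Qed.

Lemma functionalZ a f : continuous f -> L (fun x => a * f x) = a * L f.
Proof.
move=> cf; have := Llin a cf (@continuous_const 0); rewrite L0 addr0 => <-.
by congr L; apply/funext => x; rewrite addr0.
Qed.

Lemma functional_cst c : L (fun=> c) = c.
Proof.
have [_ _ L1] := Lpos.
rewrite -[RHS]mulr1 -[in RHS]L1 -functionalZ; last exact: continuous_const.
by congr L; apply/funext => x; rewrite mulr1.
Qed.

Lemma le_functional f g : continuous f -> continuous g ->
  (forall x, f x <= g x) -> L f <= L g.
Proof.
move=> cf cg fg.
have [_ Lge0 _] := Lpos.
have := Lge0 _ (@continuous_lin (-1) _ _ cf cg); rewrite Llin// => h.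
suff : 0 <= -1 * L f + L g by lra.
by apply: h => x; have := fg x; lra.
Qed.

Definition subordinate U : set (X -> R) :=
  [set f : X -> R | [/\ continuous f, forall x, 0 <= f x <= 1
             & forall x, ~ U x -> f x = 0]].

Definition inner_content U : R := sup [set L f | f in subordinate U].
Local Notation nu := inner_content.

Let sub0 U : subordinate U (fun=> 0).
Proof. by split=> // [|_]; [exact: continuous_const|rewrite lexx ler01]. Qed.

Let content_has_sup U : has_sup [set L f | f in subordinate U].
Proof.
split; first by exists (L (fun=> 0)); exists (fun=> 0).
exists 1 => _ [f [cf f01 _] <-]; rewrite -(functional_cst 1).
by apply: le_functional => // [|x]; [exact: continuous_const|case/andP: (f01 x)].
Qed.

Lemma subordinate_le U f : subordinate U f -> L f <= nu U.
Proof. by move=> fU; apply: ub_le_sup; [exact: (content_has_sup U).2|exists f]. Qed.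

Lemma content_le U c : (forall f, subordinate U f -> L f <= c) -> nu U <= c.
Proof.
move=> H; apply: ge_sup; first exact: (content_has_sup U).1.
by move=> _ [f fU <-]; exact: H.
Qed.

Lemma content_adherent U e : 0 < e -> exists2 f, subordinate U f & nu U - e < L f.
Proof. by move=> e0; have [_ [f fU <-] h] := sup_adherent e0 (content_has_sup U); exists f. Qed.

Lemma content_ge0 U : 0 <= nu U.
Proof. by rewrite -L0; exact: subordinate_le. Qed.

Lemma le_content U V : U `<=` V -> nu U <= nu V.
Proof.
move=> UV; apply: content_le => f [cf f01 f0]; apply: subordinate_le.
by split=> // x nV; apply: f0 => Ux; exact/nV/UV.
Qed.

Lemma content0 : nu set0 = 0.
Proof.
apply/eqP; rewrite eq_le content_ge0 andbT; apply: content_le => f [cf f01 f0].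
by rewrite (_ : f = fun=> 0) ?L0//; apply/funext => x; exact: f0.
Qed.

Lemma contentT : nu setT = 1.
Proof.
apply/eqP; rewrite eq_le; apply/andP; split.
  by apply: content_le => f [cf f01 _]; rewrite -(functional_cst 1);
    apply: le_functional => // [|x]; [exact: continuous_const|case/andP: (f01 x)].
rewrite -(functional_cst 1); apply: subordinate_le; split => //.
- exact: continuous_const.
- by move=> x; rewrite ler01 lexx.
- by move=> x nx; exfalso; exact: nx.
Qed.

(** Cutting a function off at height [e] costs at most [e] in the functional, and
    the result vanishes outside the closed set where the function is at least
    [e].  It stands in for functions with support inside an open set. *)
Definition shave (e : R) f : X -> R := fun x => Num.max (f x - e) 0.

Lemma continuous_shave e f : continuous f -> continuous (shave e f).
Proof.
move=> cf x.
apply: (@continuous_max R X (fun x => f x - e) (fun=> 0) x); last exact: cvg_cst.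
by apply: (@cvgB _ R^o); [exact: cf|exact: cvg_cst].
Qed.

Lemma shaveE e f x : shave e f x = if e <= f x then f x - e else 0.
Proof.
rewrite /shave; case: ifPn => h; first by apply: max_l; lra.
by apply: max_r; rewrite -ltNge in h; lra.
Qed.

Lemma subordinate_shave e U V f : 0 < e -> subordinate V f ->
  (forall x, e <= f x -> U x) -> subordinate U (shave e f).
Proof.
move=> e0 [cf f01 f0] sub; split; first exact: continuous_shave.
  by move=> x; rewrite shaveE; have := f01 x; case: ifPn; lra.
by move=> x nU; rewrite shaveE; case: ifPn => // /sub.
Qed.

Lemma functional_shave e U f : 0 < e -> subordinate U f ->
  L f <= L (shave e f) + e.
Proof.
move=> e0 [cf f01 _]; rewrite -[X in _ <= _ + X]functional_cst -functionalD.
- apply: le_functional => //.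
    move=> x; apply: (@cvgD _ R^o); [exact: continuous_shave|exact: cvg_cst].
  by move=> x; rewrite shaveE; case: ifPn; rewrite -?ltNge; lra.
- exact: continuous_shave.
- exact: continuous_const.
Qed.

Lemma separate (A B : set X) : closed A -> closed B -> A `&` B = set0 ->
  exists f : X -> R, [/\ continuous f, forall x, 0 <= f x <= 1,
    forall x, A x -> f x = 0 & forall x, B x -> f x = 1].
Proof.
move=> cA cB AB.
have nX : normal_space X by exact: compact_normal.
have /(uniform_separatorP (R := R))[f [cf f01 f0 f1]] :=
  (@normal_separatorP R X).1 nX A B cA cB AB.
exists f; split => //.
- move=> x; have : range f (f x) by exists x.
  by move=> /f01; rewrite /= in_itv.
- by move=> x Ax; apply: f0; exists x.
- by move=> x Bx; apply: f1; exists x.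
Qed.

Lemma closed_ge (e : R) f : continuous f -> closed [set x | e <= f x].
Proof.
move=> cf; rewrite (_ : [set x | _] = f @^-1` [set y | e <= y]) //.
by apply: preimage_closed => // ? ?; exact: cf.
Qed.

(** A Urysohn function that is 1 where [e <= f x] outside [V], and 0 outside [U],
    splits the shaved function into a part living on [U] and
    a part living on [V]. *)
Lemma contentU U V : open U -> open V -> nu (U `|` V) <= nu U + nu V.
Proof.
move=> oU oV; apply: content_le => f fUV; apply/ler_addgt0Pr => e e0.
have [cf f01 f0] := fUV.
have clK : closed ([set x | e <= f x] `\` V).
  by apply: closedI; [exact: closed_ge|exact: open_closedC].
have [|h [ch h01 h0 h1]] := separate (open_closedC oU) clK.
  rewrite -subset0 => x [/= nU [/= ef nV]]; have : f x = 0 by apply: f0 => -[].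
  by move=> fx; move: ef; rewrite fx; lra.
have cs := @continuous_shave e f cf.
apply: le_trans (functional_shave e0 fUV) _; rewrite lerD2r.
have -> : shave e f = fun x => h x * shave e f x + (1 - h x) * shave e f x.
  by apply/funext => x; rewrite -mulrDl addrC subrK mul1r.
have ch1 : continuous (fun x => 1 - h x).
  by move=> x; apply: (@cvgB _ R^o); [exact: cvg_cst|exact: ch].
have c1 : continuous (fun x => h x * shave e f x).
  by move=> x; apply: cvgM; [exact: ch|exact: cs].
have c2 : continuous (fun x => (1 - h x) * shave e f x).
  by move=> x; apply: cvgM; [exact: ch1|exact: cs].
have s01 x : 0 <= shave e f x <= 1.
  by rewrite shaveE; have := f01 x; case: ifPn; lra.
rewrite functionalD//; apply: lerD; apply: subordinate_le; split => //.
- move=> x; have := h01 x; have := s01 x => /andP[a b] /andP[c d].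
  by rewrite mulr_ge0//= mulr_ile1.
- by move=> x nU; rewrite h0 ?mul0r.
- move=> x; have := h01 x; have := s01 x => /andP[a b] /andP[c d].
  by rewrite mulr_ge0 ?mulr_ile1//; lra.
- move=> x nV; rewrite shaveE; case: ifPn => ef; last by rewrite mulr0.
  by rewrite h1 ?subrr ?mul0r.
Qed.

(** The set where [e <= f x] is compact, so finitely many of the [U n] already
    contain it. *)
Lemma content_bigcup (U : nat -> set X) f e : (forall n, open (U n)) ->
  subordinate (\bigcup_n U n) f -> 0 < e ->
  exists N, L f <= \sum_(n < N) nu (U n) + e.
Proof.
move=> oU fU e0; have [cf f01 f0] := fU.
have : compact [set x | e <= f x].
  by apply: subclosed_compact cX _ => //; exact: closed_ge.
rewrite compact_cover => /(_ nat setT U (fun n _ => oU n))[].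
  by move=> x /= ef; apply: contrapT => /f0 fx; move: ef; rewrite fx; lra.
move=> D _ KD.
have [N DN] : exists N, forall i, i \in D -> (i < N)%N.
  exists (\max_(i <- enum_fset D) i).+1 => i iD; rewrite ltnS.
  by rewrite (leq_bigmax_seq (F := id)).
exists N; apply: le_trans (functional_shave e0 fU) _; rewrite lerD2r.
have fN : subordinate (\big[setU/set0]_(n < N) U n) (shave e f).
  apply: subordinate_shave fU _ => // x /KD[i /= iD Ui].
  by rewrite -bigcup_mkord; exists i => //; exact: DN.
apply: le_trans (subordinate_le fN) _; elim: N {DN fN} => [|N IH].
  by rewrite !big_ord0 content0.
rewrite !big_ord_recr/=; apply: le_trans (contentU _ _) _ => //.
  by rewrite -bigcup_mkord; exact: bigcup_open.
by rewrite lerD2r.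
Qed.

Let covers (A : set X) : set R := [set nu U | U in [set U | open U /\ A `<=` U]].

Definition outer_content (A : set X) : R := inf (covers A).
Local Notation mu := outer_content.

Let covers_has_inf A : has_inf (covers A).
Proof.
split; first by exists (nu setT); exists setT => //; split => //; exact: openT.
by exists 0 => _ [U _ <-]; exact: content_ge0.
Qed.

Lemma outer_content_le A U : open U -> A `<=` U -> mu A <= nu U.
Proof. by move=> oU AU; apply: ge_inf; [exact: (covers_has_inf A).2|exists U]. Qed.

Lemma outer_content_adherent A e : 0 < e ->
  exists U, [/\ open U, A `<=` U & nu U < mu A + e].
Proof. by move=> e0; have [_ [U [oU AU] <-] h] := inf_adherent e0 (covers_has_inf A); exists U. Qed.

Lemma outer_content_open U : open U -> mu U = nu U.
Proof.
move=> oU; apply/eqP; rewrite eq_le outer_content_le//=.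
apply: lb_le_inf; first exact: (covers_has_inf U).1.
by move=> _ [V [oV UV] <-]; exact: le_content.
Qed.

Lemma outer_content_ge0 A : 0 <= mu A.
Proof.
apply: lb_le_inf; first exact: (covers_has_inf A).1.
by move=> _ [V _ <-]; exact: content_ge0.
Qed.

Definition outer_content_ereal (A : set X) : \bar R := (mu A)%:E.

Let emu0 : outer_content_ereal set0 = 0%E.
Proof. by rewrite /outer_content_ereal outer_content_open ?content0//; exact: open0. Qed.

Let emu_ge0 A : (0 <= outer_content_ereal A)%E.
Proof. by rewrite lee_fin outer_content_ge0. Qed.

Let le_emu : {homo outer_content_ereal : A B / A `<=` B >-> (A <= B)%E}.
Proof.
move=> A B AB; rewrite lee_fin; apply: lb_le_inf; first exact: (covers_has_inf B).1.
by move=> _ [V [oV BV] <-]; apply: outer_content_le => //; exact: subset_trans BV.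
Qed.

Let sum_half (e : R) N : \sum_(n < N) (e / 2 ^+ n.+1) = e - e / 2 ^+ N.
Proof.
elim: N => [|N IH]; first by rewrite big_ord0 expr0 divr1 subrr.
by rewrite big_ord_recr/= IH exprS invfM; field; exact: expf_neq0.
Qed.

Let emu_sigma : sigma_subadditive outer_content_ereal.
Proof.
move=> F; apply/lee_addgt0Pr => e e0.
have e20 : 0 < e / 2 by lra.
have /choice[U UP] : forall n, exists U,
    [/\ open U, F n `<=` U & nu U < mu (F n) + e / 2 / 2 ^+ n.+1].
  by move=> n; apply: outer_content_adherent; rewrite divr_gt0// exprn_gt0.
have oU n : open (U n) by case: (UP n).
set S := (\sum_(i <oo) outer_content_ereal (F i))%E.
have Sfin : S = +oo%E \/ S \is a fin_num.
  have : (0 <= S)%E by exact: nneseries_ge0.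
  by case: (S) => // [r|]; [right|left].
case: Sfin => [->|/fineK Sfin]; first by rewrite addye ?leey.
rewrite -Sfin -EFinD lee_fin.
apply: (@le_trans _ _ (nu (\bigcup_n U n))).
  apply: outer_content_le; first exact: bigcup_open.
  by apply: subset_bigcup => n _; case: (UP n).
apply: content_le => f fU; have [N] := content_bigcup oU fU e20.
move/le_trans; apply.
rewrite [in leRHS](splitr e) addrA lerD2r.
apply: (@le_trans _ _ (\sum_(n < N) (mu (F n) + e / 2 / 2 ^+ n.+1))).
  by apply: ler_sum => n _; case: (UP n) => _ _ /ltW.
rewrite big_split/= sum_half; apply: lerD; last first.
  by rewrite gerBl divr_ge0 ?exprn_ge0// ltW.
rewrite -lee_fin Sfin -sumEFin -(big_mkord xpredT (outer_content_ereal \o F)).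
by apply: nneseries_lim_ge => n _ _; exact: emu_ge0.
Qed.

HB.instance Definition _ := isOuterMeasure.Build R X outer_content_ereal
  emu0 emu_ge0 le_emu emu_sigma.

(** Fill an open [V] containing the test set from inside: first with some [f] on
    [U `&` V], then with some [g] on the part of [V] where [f < e / 4].  After
    shaving, [f] and [g] have disjoint supports, so their sum is still
    subordinate to [V]. *)
Lemma open_caratheodory U : open U -> outer_content_ereal.-caratheodory U.
Proof.
move=> oU; apply: le_caratheodory_measurable => A.
rewrite -EFinD lee_fin; apply/ler_addgt0Pr => e e0.
have e40 : 0 < e / 4 by lra.
have [V [oV AV nuV]] := outer_content_adherent A e40.
have [f fUV Lf] := content_adherent (U `&` V) e40.
have [cf f01 f0] := fUV.
pose W := V `&` ~` [set x | e / 4 <= f x].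
have oW : open W by apply: openI => //; exact/closed_openC/closed_ge.
have [g gW Lg] := content_adherent W e40; have [cg g01 g0] := gW.
have muW : mu (A `&` ~` U) <= nu W.
  apply: outer_content_le => // x [Ax nUx]; split; first exact: AV.
  by rewrite /= f0; [lra|case].
have muU : mu (A `&` U) <= nu (U `&` V).
  by apply: outer_content_le; [exact: openI|move=> x [Ax Ux]; split => //; exact: AV].
have fs := functional_shave e40 fUV.
have sV : subordinate V (fun x => shave (e / 4) f x + g x).
  split.
  - by move=> x; apply: (@cvgD _ R^o); [exact: continuous_shave|exact: cg].
  - move=> x; rewrite shaveE; case: ifPn => ef; last by rewrite add0r.
    rewrite g0; first by have := f01 x; lra.
    by move=> [_]; exact.
  - move=> x nV; rewrite shaveE g0; last by case.
    have -> : f x = 0 by apply: f0; case.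
    by rewrite addr0; case: ifPn => // ?; lra.
have := subordinate_le sV; rewrite functionalD//; first by lra.
exact: continuous_shave.
Qed.

Lemma borel_caratheodory (A : set (borel X)) :
  measurable A -> outer_content_ereal.-caratheodory A.
Proof.
apply: (@smallest_sub _ (sigma_algebra setT) (@open X)
  (outer_content_ereal.-caratheodory : set (set X))); last first.
  by move=> U oU; exact: open_caratheodory.
exact: (@sigma_algebra_measurable _ (caratheodory_type outer_content_ereal)).
Qed.

Definition riesz_measure : set (borel X) -> \bar R := outer_content_ereal.

Let riesz_sigma_additive : semi_sigma_additive riesz_measure.
Proof.
move=> F mF tF mUF; apply: (@caratheodory_measure_sigma_additive R X outer_content_ereal F) => //.
  by move=> i; exact: (borel_caratheodory (mF i)).
exact: (borel_caratheodory mUF).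
Qed.

HB.instance Definition _ := isMeasure.Build _ _ _ riesz_measure
  emu0 emu_ge0 riesz_sigma_additive.

Let riesz_setT : riesz_measure setT = 1%E.
Proof.
by rewrite /riesz_measure/outer_content_ereal outer_content_open ?contentT//; exact: openT.
Qed.

HB.instance Definition _ := Measure_isProbability.Build _ _ _ riesz_measure riesz_setT.

Lemma open_borel U : open U -> measurable (U : set (borel X)).
Proof. exact: sub_sigma_algebra. Qed.

Lemma continuous_borel f : continuous f -> measurable_fun [set: borel X] f.
Proof.
move=> cf; apply: (measurability _ (RGenOInfty.measurableE R)).
move=> _ [_ [a ->] <-]; rewrite setTI; apply: open_borel.
by move/continuousP: cf; apply; exact: interval_open.
Qed.

(** Outer regularity on the complement is inner regularity, because complements
    of open sets are compact. *)
Lemma riesz_regular : regular_measure riesz_measure.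
Proof.
move=> A mA; apply/eqP; rewrite eq_le; apply/andP; split; last first.
  by apply: ge_ereal_sup => _ [K [_ KA] <-]; exact: le_emu.
apply/lee_addgt0Pr => e e0.
have [U [oU AU nuU]] := outer_content_adherent (~` A) e0.
pose K := ~` U.
have cK : closed K by exact: open_closedC.
have KA : K `<=` A by move=> x; apply: contra_notP => /AU.
apply: (@le_trans _ _ (riesz_measure K + e%:E)%E); last first.
  rewrite leeD2r//; apply: ereal_sup_ubound; exists K => //; split => //.
  exact: subclosed_compact cX _.
have mK : measurable (K : set (borel X)) by apply: measurableC; exact: open_borel.
have eA := probability_setC riesz_measure mA.
have eK := probability_setC riesz_measure mK.
move: eA eK nuU; rewrite setCK /riesz_measure /outer_content_ereal -!EFinB => -[eA] -[eK].
by rewrite -EFinD lee_fin -(outer_content_open oU) eK eA; lra.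
Qed.

Let layer_sum (a : R) N : 0 <= a ->
  \sum_(k < N) (k%:R < a)%R%:R <= a + 1.
Proof.
move=> a0; elim: N => [|N IH]; first by rewrite big_ord0; lra.
rewrite big_ord_recr/=; case: ltP => [Na|aN]; last by rewrite addr0.
apply: (@le_trans _ _ (N%:R + 1)); last by lra.
rewrite lerD2r; apply: le_trans (_ : \sum_(k < N) 1 <= _).
  by apply: ler_sum => i _; case: ltP.
by rewrite sumr_const card_ord.
Qed.

(** Cut [n * h] into [n] layers of height 1.  The layer between [k] and [k + 1] is
    subordinate to the set [A k] where [n * h > k], so [n * L h] is at most the
    sum of the measures of the [A k], which is the integral of the function that
    counts the [k] with [k < n * h], and this function is at most [n * h + 1]. *)
Lemma functional_le_integral h : continuous h -> (forall x, 0 <= h x <= 1) ->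
  ((L h)%:E <= \int[riesz_measure]_x (h x)%:E)%E.
Proof.
move=> ch h01; apply/lee_addgt0Pr => e e0.
have [N Ne] : exists N, N.+1%:R^-1 < e.
  by exists (Num.bound e^-1); rewrite invf_plt ?posrE//;
    apply: lt_trans (archi_boundP _) _; rewrite ?invr_ge0 ?ltr_nat// ltW.
pose n : R := N.+1%:R; have n0 : 0 < n by rewrite ltr0n.
pose A k := [set x | k%:R < n * h x].
pose c k x := Num.min (n * h x) k%:R.
have oA k : open (A k).
  rewrite (_ : A k = (fun x => n * h x) @^-1` [set y | k%:R < y])//.
  apply: open_comp; last exact: open_gt.
  by move=> x _; apply: cvgM; [exact: cvg_cst|exact: ch].
have cc k : continuous (c k).
  move=> x; apply: (@continuous_min R X (fun x => n * h x) (fun=> k%:R) x).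
    by apply: cvgM; [exact: cvg_cst|exact: ch].
  exact: cvg_cst.
have cE k x : c k x = if k%:R < n * h x then k%:R else n * h x.
  rewrite /c; case: ifPn => H; first by apply: min_r; exact: ltW.
  by apply: min_l; rewrite leNgt.
have cS k : L (c k.+1) <= L (c k) + nu (A k).
  have s : subordinate (A k) (fun x => -1 * c k x + c k.+1 x).
    split; first exact: continuous_lin.
    - by move=> x; rewrite !cE -natr1; case: ifPn; case: ifPn; rewrite -?leNgt; lra.
    - move=> x /negP; rewrite /= -leNgt => H; rewrite !cE -natr1.
      by case: ifPn; case: ifPn; rewrite -?leNgt; lra.
  by have := subordinate_le s; rewrite Llin//; lra.
have cL k : L (c k) <= \sum_(i < k) nu (A i).
  elim: k => [|k IH]; last by rewrite big_ord_recr/=; have := cS k; lra.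
  rewrite big_ord0 (_ : c 0%N = fun=> 0) ?L0//; apply/funext => x; rewrite cE.
  case: ifPn => //; rewrite -leNgt => H; apply/eqP; rewrite eq_le H/=.
  by rewrite mulr_ge0 ?(ltW n0)//; have /andP[] := h01 x.
have nL : L h <= n^-1 * \sum_(i < N.+1) nu (A i).
  rewrite mulrC ler_pdivlMr// mulrC -functionalZ//.
  apply: le_trans (cL N.+1); rewrite (_ : c N.+1 = fun x => n * h x)//.
  apply/funext => x; rewrite cE -/n; case: ifPn => //.
  by rewrite ltNge; case/andP: (h01 x) => _ /(ler_wpM2l (ltW n0)); rewrite mulr1 => ->.
have mh : measurable_fun [set: borel X] h by exact: continuous_borel.
have mA i : measurable_fun [set: borel X] (\1_(A i) : X -> R).
  by apply: measurable_indic; exact: open_borel.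
apply: (@le_trans _ _ (\int[riesz_measure]_x (h x + n^-1)%:E)%E); last first.
  under eq_integral do rewrite EFinD.
  rewrite ge0_integralD//; last 3 first.
  - by move=> x _; rewrite lee_fin; case/andP: (h01 x).
  - exact/measurable_EFinP.
  - by move=> x _; rewrite lee_fin invr_ge0 ltW.
  rewrite leeD2l// integral_cst// -[X in (X <= _)%E]/((n^-1)%:E * riesz_measure setT)%E.
  by rewrite probability_setT mule1 lee_fin ltW.
apply: (@le_trans _ _ (n^-1 * \sum_(i < N.+1) nu (A i))%:E); first by rewrite lee_fin.
have -> : (n^-1 * \sum_(i < N.+1) nu (A i))%:E =
    (\int[riesz_measure]_x (\sum_(i < N.+1) (n^-1)%:E * (\1_(A i) x)%:E))%E.
  rewrite ge0_integral_sum//; last 2 first.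
  - move=> i; apply/measurable_EFinP/measurable_funM; first exact: measurable_cst.
    exact: mA.
  - by move=> i x _; rewrite -EFinM lee_fin mulr_ge0 ?invr_ge0 ?(ltW n0).
  rewrite mulr_sumr -sumEFin; apply: eq_bigr => i _.
  rewrite ge0_integralZl//; last 2 first.
  - by apply/measurable_EFinP; exact: mA.
  - by rewrite lee_fin invr_ge0 ltW.
  rewrite integral_indic//; last exact: open_borel.
  by rewrite setIT EFinM -(outer_content_open (oA i)).
apply: ge0_le_integral => //.
- by move=> x _; apply: sume_ge0 => i _; rewrite -EFinM lee_fin mulr_ge0 ?invr_ge0 ?(ltW n0).
- by apply: emeasurable_sum => i; apply/measurable_EFinP/measurable_funM.
- by apply/measurable_EFinP/measurable_funD.
move=> x _; rewrite (eq_bigr (fun i : 'I_N.+1 => (n^-1 * (i%:R < n * h x)%R%:R)%:E)).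
  rewrite sumEFin lee_fin -mulr_sumr mulrC ler_pdivrMr// mulrDl mulVf ?gt_eqF//.
  by rewrite mulrC layer_sum// mulr_ge0 ?(ltW n0)//; have /andP[] := h01 x.
move=> i _; rewrite -EFinM indicE; congr (_ * _%:R)%:E.
by congr nat_of_bool; apply/idP/idP => [/set_mem//|H]; exact/mem_set.
Qed.

(** Apply the inequality to [h] and to [1 - h]. *)
Lemma integral_riesz h : continuous h -> (forall x, 0 <= h x <= 1) ->
  (\int[riesz_measure]_x (h x)%:E = (L h)%:E)%E.
Proof.
move=> ch h01; have mh : measurable_fun [set: borel X] h by exact: continuous_borel.
have ch' : continuous (fun x => -1 * h x + 1).
  by apply: continuous_lin => //; exact: continuous_const.
have h01' x : 0 <= -1 * h x + 1 <= 1 by have := h01 x; lra.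
have := functional_le_integral ch' h01'.
rewrite Llin//; last exact: continuous_const.
rewrite functional_cst => H.
apply/eqP; rewrite eq_le functional_le_integral// andbT.
have : (\int[riesz_measure]_x (h x)%:E + \int[riesz_measure]_x (-1 * h x + 1)%:E = 1)%E.
  rewrite -ge0_integralD//; last 4 first.
  - by move=> x _; rewrite lee_fin; case/andP: (h01 x).
  - exact/measurable_EFinP.
  - by move=> x _; rewrite lee_fin; case/andP: (h01' x).
  - by apply/measurable_EFinP; exact: continuous_borel.
  rewrite -[RHS](probability_setT riesz_measure) -[RHS]mul1e -integral_cst//.
  by apply: eq_integral => x _; rewrite -EFinD; congr _%:E; ring.
move: H; set A := integral _ _ _; set B := integral _ _ _.
case: A => [a| |]; case: B => [b| |] //.
by rewrite -EFinD !lee_fin => H [E]; lra.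
Qed.

Theorem riesz_markov : exists2 mu : probability (borel X) R, regular_measure mu &
    forall h, continuous h -> (forall x, 0 <= h x <= 1) ->
      (\int[mu]_x (h x)%:E = (L h)%:E)%E.
Proof.
exists (riesz_measure : probability (borel X) R); first exact: riesz_regular.
exact: integral_riesz.
Qed.
End Riesz.

(** * Nearly constant combinations of translates on a boundary *)

Section BoundedFunctions.
Variables (R : realType) (T : Type).

Definition bounded_functions : {pred T -> R^o} :=
  [pred f : T -> R^o | `[< exists M : R, forall t, `|f t| <= M >]].

Lemma bounded_functions_submod : subsemimod_closed bounded_functions.
Proof.
split; first split.
- by apply/asboolP; exists 0 => t; rewrite normr0.
- move=> f g /asboolP[M fM] /asboolP[N gN]; apply/asboolP; exists (M + N) => t.
  by apply: le_trans (ler_normD _ _) _; exact: lerD.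
- move=> c f /asboolP[M fM]; apply/asboolP; exists (`|c| * M) => t.
  by rewrite normrM ler_wpM2l.
Qed.

HB.instance Definition _ := GRing.isSubmodClosed.Build _ _ bounded_functions
  bounded_functions_submod.

Definition bfun := {f : T -> R^o | f \in bounded_functions}.
HB.instance Definition _ := SubChoice.on bfun.
HB.instance Definition _ := [SubChoice_isSubLmodule of bfun by <:].
End BoundedFunctions.

Section Covering.
Variables (R : realType) (G : groupType) (X : ptopologicalType).
Variable act : G -> X -> X.
Hypothesis hX : boundary R act.
Implicit Types (f : X -> R) (s : seq (R * G)).

Let cX : compact [set: X]. Proof. by case: hX. Qed.
Let hausX : hausdorff_space X. Proof. by case: hX. Qed.
Let act1 x : act 1%g x = x. Proof. by case: hX => _ _ []. Qed.
Let actM g k x : act (g * k)%g x = act g (act k x).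
Proof. by case: hX => _ _ []. Qed.
Let cact g : continuous (act g). Proof. by case: hX => _ _ []. Qed.

Lemma continuous_bounded f : continuous f ->
  exists M, forall x, `|f x| <= M.
Proof.
move=> cf; have : bounded_set (f @` setT : set R^o).
  apply: compact_bounded; apply: continuous_compact => //.
  exact: continuous_subspaceT.
by case=> M [_ /(_ (M + 1))] H; exists (M + 1) => x; apply: H; [rewrite ltrDl|exists x].
Qed.

(** The closure of the orbit of [z] is closed and invariant, hence everything by
    minimality. *)
Lemma orbit_dense z f c z0 : continuous f -> c < f z0 -> exists g, c < f (act g z).
Proof.
move=> cf fz0.
have [_ _ _ minX _] := hX.
pose O := [set act g z | g in [set: G]].
have OT : closure O = setT.
  apply: minX.
  - exact: closed_closure.
  - by exists z; apply: subset_closure; exists 1%g.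
  - move=> g _ [y Oy <-] B /(cact (x := y)) /Oy[_ [[k _ <-] Bk]].
    by exists (act g (act k z)); split => //; exists (g * k)%g.
have : closure O z0 by rewrite OT.
move=> /(_ (f @^-1` [set r | c < r])) [].
  by apply: cf; apply: open_nbhs_nbhs; split => //; exact: open_gt.
by move=> _ [[g _ <-] fg]; exists g.
Qed.

(** Represent [L] by a measure and let [g] bring it near a point mass at some [z].
    The group element [k] moves [z] to where [f] exceeds [c], and testing the
    approximation against [f \o act k] gives the bound for [k * g]. *)
Lemma proximal_functional (L : (X -> R) -> R) f c z0 :
  positive_functional L -> continuous f -> (forall x, 0 <= f x <= 1) ->
  c < f z0 -> exists g, c < L (f \o act g).
Proof.
move=> Lpos cf f01 cz0; have [mu regmu intmu] := riesz_markov cX hausX Lpos.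
have [_ _ _ _ /(_ mu regmu)[z zcl]] := hX.
have [k ck] := orbit_dense z cf cz0.
have cfk : continuous (f \o act k).
  by move=> y; apply: continuous_comp; [exact: cact|exact: cf].
have mact g : measurable_fun [set: borel X] (act g : borel X -> borel X).
  apply: (@measurability _ _ (borel X) (borel X) setT (act g) (@open X)) => // _ [U oU <-].
  rewrite setTI; apply: open_borel; apply: open_comp => // y _; exact: cact.
have mfk : measurable_fun [set: borel X] (fun y => ((f \o act k) y)%:E).
  by apply/measurable_EFinP; exact: continuous_borel.
pose phi : continuousType X R := mkcts cfk.
have [] := zcl [set F : {ptws continuousType X R -> R} | c < F phi].
  apply: (@proj_continuous (continuousType X R) (fun=> (R : topologicalType)) phi
    (integral_functional (dirac (z : borel X))) [set r : R | c < r]).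
  apply: open_nbhs_nbhs; split; first exact: open_gt.
  rewrite /= /proj /integral_functional integral_dirac//.
  by rewrite diracT mul1e.
move=> _ [[g _ <-] /=]; rewrite /integral_functional => H; exists (k * g)%g.
move: H; rewrite ge0_integral_pushforward//; last first.
  by move=> y _; rewrite lee_fin; case/andP: (f01 (act k y)).
rewrite preimage_setT (_ : (fun x => _) = fun y => ((f \o act (k * g)%g) y)%:E).
  rewrite intmu//.
    by move=> y; apply: continuous_comp; [exact: cact|exact: cf].
  by move=> x; exact: f01.
by apply/funext => y /=; rewrite actM.
Qed.

(** Otherwise no function [C s] of the cone generated by the [c - f \o act g] is
    negative everywhere.  Then the least [r] such that [h + C s <= r] for some
    [s] is a sublinear function of [h], and a linear functional below it is
    positive, normalized and at most [c] on all translates of [f], against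
    [proximal_functional]. *)
Lemma covering_combination f z0 c : continuous f -> (forall x, 0 <= f x <= 1) ->
  c < f z0 ->
  exists2 s, (forall p, p \in s -> 0 <= p.1) &
    forall y, 0 < \sum_(p <- s) p.1 * (f (act p.2 y) - c).
Proof.
move=> cf f01 cz0; apply: contrapT => nex.
pose C s y := \sum_(p <- s) p.1 * (c - f (act p.2 y)).
pose nng s := forall p, p \in s -> 0 <= p.1 :> R.
have Cge s : nng s -> exists y, 0 <= C s y.
  move=> s0; apply: contrapT => ny; apply: nex; exists s => // y.
  rewrite ltNge; apply/negP => H; apply: ny; exists y; move: H.
  rewrite -oppr_ge0 -sumrN; congr (_ <= _).
  by apply: eq_bigr => p _; rewrite -mulrN opprB.
(* The infimum of [S h] is the infimum over the cone of [sup (h + C s)]. *)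
pose S (h : bfun R X) :=
  [set r : R | exists2 s, nng s & forall y, (val h y : R) + C s y <= r].
have C0 y : C [::] y = 0 by rewrite /C big_nil.
have bh (h : bfun R X) : exists M : R, forall y, `|val h y| <= M.
  by apply/asboolP; exact: (valP h).
have hiS h : has_inf (S h).
  have [M hM] := bh h; split.
    exists M, [::] => // y; rewrite C0 addr0; apply: le_trans (hM y).
    exact: ler_norm.
  exists (- M) => r [s /Cge[y Cy] /(_ y)].
  have : - M <= val h y by have := hM y; rewrite ler_norml => /andP[].
  by move: (val h y : R) => v; lra.
have Sle h r : S h r -> inf (S h) <= r by move=> Sr; apply: ge_inf => //; exact: (hiS h).2.
have ps : sublinear (fun h => inf (S h)).
  split.
    move=> h1 h2; apply/ler_addgt0Pr => e e0; have e20 : 0 < e / 2 by lra.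
    have [r1 [s1 n1 H1] l1] := inf_adherent e20 (hiS h1).
    have [r2 [s2 n2 H2] l2] := inf_adherent e20 (hiS h2).
    apply: (@le_trans _ _ (r1 + r2)); last by lra.
    apply: Sle; exists (s1 ++ s2).
      by move=> p; rewrite mem_cat => /orP[/n1|/n2].
    move=> y; rewrite /C big_cat/= -/(C s1 y) -/(C s2 y).
    rewrite -[X in X + _ <= _]/((val h1 y : R) + (val h2 y : R)) addrACA.
    exact: lerD (H1 y) (H2 y).
  move=> a h; rewrite le_eqVlt => /predU1P[<-|a0].
    rewrite scale0r mul0r; apply: Sle; exists [::] => // y.
    by rewrite C0 addr0.
  rewrite mulrC -ler_pdivrMr//; apply: lb_le_inf; first exact: (hiS h).1.
  move=> r [s s0 H]; rewrite ler_pdivrMr//; apply: Sle.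
  exists [seq (a * p.1, p.2) | p <- s].
    by move=> _ /mapP[p /s0 p0 ->]; rewrite mulr_ge0 // ltW.
  move=> y; change (a * (val h y : R) + C [seq (a * p.1, p.2) | p <- s] y <= r * a).
  have -> : C [seq (a * p.1, p.2) | p <- s] y = a * C s y.
    by rewrite /C big_map mulr_sumr; apply: eq_bigr => p _ /=; rewrite mulrA.
  by rewrite -mulrDr mulrC ler_wpM2r// ltW.
have [m [mlin mp]] := hahn_banach ps.
have mle h r : (forall y, (val h y : R) <= r) -> m h <= r.
  move=> hr; apply: le_trans (mp h) _; apply: Sle; exists [::] => // y.
  by rewrite C0 addr0.
have mN h : m (- h) = - m h.
  have m0 : m 0 = 0 by have := mlin 1 0 0; rewrite scaler0 addr0; lra.
  by have := mlin (-1) h 0; rewrite addr0 m0 scaleN1r; lra.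
pose B f : bfun R X := insubd 0 f.
have BE f' : continuous f' -> val (B f') = f'.
  by move=> cf'; rewrite insubdK//; apply/asboolP; exact: continuous_bounded.
have c1 : continuous ((fun=> 1) : X -> R) by move=> ?; exact: cvg_cst.
have Lpos : positive_functional (fun f => m (B f)).
  split.
  - move=> a f1 f2 cf1 cf2; rewrite -mlin; congr m; apply/val_inj.
    rewrite BE; last exact: continuous_lin.
    by rewrite -[RHS]/(a *: val (B f1) + val (B f2)) !BE.
  - move=> f1 cf1 f10; rewrite -oppr_le0 -mN; apply: mle => y.
    rewrite -[X in X <= _]/(- (val (B f1) y : R)) BE// oppr_le0; exact: f10.
  - apply/eqP; rewrite eq_le mle/=; last by move=> y; rewrite BE.
    by rewrite -lerN2 -mN; apply: mle => y; rewrite -[X in X <= _]/(- (val (B _) y : R)) BE.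
have [g] := proximal_functional Lpos cf f01 cz0.
have cfg : continuous (f \o act g).
  by move=> y; apply: continuous_comp; [exact: cact|exact: cf].
have [+ _ Lone] := Lpos; move=> /(_ (- c) (fun=> 1) (f \o act g) c1 cfg).
rewrite Lone => E; suff : m (B (fun x => - c * 1 + (f \o act g) x)) <= 0 by rewrite E; lra.
apply: le_trans (mp _) _; apply: Sle; exists [:: (1, g)].
  by move=> p; rewrite inE => /eqP ->.
move=> y; rewrite BE; last exact: continuous_lin.
by rewrite /C big_seq1 /=; lra.
Qed.
End Covering.

(** * Geometry of square-summable functions *)

Section SquareNorm.
Variables (R : realType) (G : groupType).
Local Notation ell := (ell2 R G).
Local Notation normc := ComplexField.Normc.normc.
Implicit Types (x y z : ell) (c : R[i]).

Lemma normc_sqr (w : R[i]) : normc w ^+ 2 = complex.Re w ^+ 2 + complex.Im w ^+ 2.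
Proof. by case: w => a b; rewrite /= sqr_sqrtr ?addr_ge0 ?sqr_ge0. Qed.

Definition normsq x : R := fine (sqnorm (val x)).

Lemma normsqE x : sqnorm (val x) = (normsq x)%:E.
Proof. by rewrite /normsq fineK// sqnorm_fin. Qed.

Lemma normsq_ge0 x : 0 <= normsq x.
Proof. by rewrite fine_ge0// sqnorm_ge0. Qed.

Lemma normsq_eq0 x : normsq x <= 0 -> x = 0.
Proof.
move=> x0; apply/val_inj; rewrite val0; apply: sqnorm_eq0.
by rewrite normsqE lee_fin.
Qed.

Lemma ge0_esumZ (T : choiceType) (D : set T) (r : R) (u : T -> \bar R) :
  0 <= r -> (forall i, (0 <= u i)%E) ->
  (\esum_(i in D) (r%:E * u i) = r%:E * \esum_(i in D) u i)%E.
Proof.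
move=> r0 u0; apply/eqP; rewrite eq_le esumZ_le//=.
have /predU1P[<-|{}r0] : (0 == r) || (0 < r) by rewrite -le_eqVlt.
  by rewrite mul0e; apply: esum_ge0 => i _; rewrite mul0e.
have ri0 : 0 <= r^-1 by rewrite invr_ge0 ltW.
have ru0 i : (0 <= r%:E * u i)%E by rewrite mule_ge0// lee_fin ltW.
have := @esumZ_le R T D _ _ ri0 ru0.
rewrite (eq_esum (b := u)); last first.
  by move=> i _; rewrite muleA -EFinM mulVf ?mul1e// gt_eqF.
move/(lee_wpmul2l (x := r%:E)); rewrite lee_fin (ltW r0) => /(_ isT).
by rewrite muleA -EFinM divff ?gt_eqF// mul1e.
Qed.

Lemma normsq_sumE (s : seq (R * ell)) : (forall p, p \in s -> 0 <= p.1) ->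
  (\sum_(p <- s) p.1 * normsq p.2)%:E =
  (\esum_(t in [set: G]) (\sum_(p <- s) p.1 * normc (val p.2 t) ^+ 2)%:E)%E.
Proof.
elim: s => [|[r x] s IH] s0.
  by rewrite big_nil esum1// => t _; rewrite big_nil.
have r0 : 0 <= r by apply: (s0 (r, x)); rewrite inE eqxx.
have s0' p : p \in s -> 0 <= p.1 by move=> ps; apply: s0; rewrite inE ps orbT.
rewrite big_cons EFinD IH// EFinM -normsqE -ge0_esumZ//; last first.
  by move=> t; rewrite lee_fin sqr_ge0.
rewrite -esumD; last 2 first.
- by move=> t _; rewrite -EFinM lee_fin mulr_ge0 ?sqr_ge0.
- move=> t _; rewrite lee_fin big_seq sumr_ge0// => p ps.
  by rewrite mulr_ge0 ?sqr_ge0// s0'.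
by apply: eq_esum => t _; rewrite big_cons EFinD EFinM.
Qed.

(** Sums of squares are compared pointwise.  The Hilbert space identities below
    are all arranged so that only such sums with nonnegative weights occur, for
    which extended-real sums are additive without summability conditions. *)
Lemma le_normsq_sum (s s' : seq (R * ell)) :
  (forall p, p \in s -> 0 <= p.1) -> (forall p, p \in s' -> 0 <= p.1) ->
  (forall t, \sum_(p <- s) p.1 * normc (val p.2 t) ^+ 2 <=
             \sum_(p <- s') p.1 * normc (val p.2 t) ^+ 2) ->
  \sum_(p <- s) p.1 * normsq p.2 <= \sum_(p <- s') p.1 * normsq p.2.
Proof.
move=> s0 s0' ss'; rewrite -lee_fin !normsq_sumE//; apply: le_esum => t _.
by rewrite lee_fin.
Qed.

Lemma eq_normsq_sum (s s' : seq (R * ell)) :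
  (forall p, p \in s -> 0 <= p.1) -> (forall p, p \in s' -> 0 <= p.1) ->
  (forall t, \sum_(p <- s) p.1 * normc (val p.2 t) ^+ 2 =
             \sum_(p <- s') p.1 * normc (val p.2 t) ^+ 2) ->
  \sum_(p <- s) p.1 * normsq p.2 = \sum_(p <- s') p.1 * normsq p.2.
Proof.
by move=> s0 s0' ss'; apply/eqP; rewrite eq_le !le_normsq_sum// => t; rewrite ss'.
Qed.

Lemma addfE (f g : G -> R[i]) t : (f + g) t = f t + g t. Proof. by []. Qed.
Lemma scalefE c (f : G -> R[i]) t : (c *: f) t = c * f t. Proof. by []. Qed.

Definition sum_listE := (big_cons, big_nil, @addr0 R, @mul1r R).

Lemma normsqZ c x : normsq (c *: x) = normc c ^+ 2 * normsq x.
Proof.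
have := @eq_normsq_sum [:: (1, c *: x)] [:: (normc c ^+ 2, x)].
rewrite !sum_listE/=; apply.
- by move=> p; rewrite inE => /eqP ->; exact: ler01.
- by move=> p; rewrite inE => /eqP ->; exact: sqr_ge0.
- by move=> t; rewrite !sum_listE/= scalefE ComplexField.Normc.normcM exprMn.
Qed.

Lemma normsq0 : normsq 0 = 0.
Proof.
have := normsqZ 0 0; rewrite scale0r => ->.
by rewrite ComplexField.Normc.normc0 expr0n mul0r.
Qed.

Lemma normsqN x : normsq (- x) = normsq x.
Proof. by rewrite -scaleN1r normsqZ normcN ComplexField.Normc.normc1 expr1n mul1r. Qed.

Lemma normsqD_weighted (r : R) x y : 0 < r ->
  normsq (x + y) <= (1 + r) * normsq x + (1 + r^-1) * normsq y.
Proof.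
move=> r0; have ri0 : 0 < r^-1 by rewrite invr_gt0.
have := @le_normsq_sum [:: (1, x + y)] [:: (1 + r, x); (1 + r^-1, y)].
rewrite !sum_listE/=; apply.
- by move=> p; rewrite inE => /eqP ->; exact: ler01.
- by move=> p; rewrite !inE => /orP[] /eqP ->/=; lra.
move=> t; rewrite !sum_listE/= !addfE !normc_sqr.
case: (val x t) => a b; case: (val y t) => a' b' /=.
have E u v : (u + v) ^+ 2 <= (1 + r) * u ^+ 2 + (1 + r^-1) * v ^+ 2 :> R.
  have -> : (1 + r) * u ^+ 2 + (1 + r^-1) * v ^+ 2 =
    (u + v) ^+ 2 + r * (u - r^-1 * v) ^+ 2 by field; rewrite gt_eqF.
  by rewrite lerDl mulr_ge0 ?sqr_ge0// ltW.
by have := E a a'; have := E b b'; lra.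
Qed.

Lemma ell2_normE x : ell2_norm x = Num.sqrt (normsq x). Proof. by []. Qed.

Lemma ell2_norm_ge0 x : 0 <= ell2_norm x. Proof. exact: sqrtr_ge0. Qed.

Lemma ell2_norm_sqr x : ell2_norm x ^+ 2 = normsq x.
Proof. by rewrite ell2_normE sqr_sqrtr// normsq_ge0. Qed.

Lemma ell2_norm_eq0 x : ell2_norm x <= 0 -> x = 0.
Proof.
move=> x0; apply: normsq_eq0; rewrite -ell2_norm_sqr.
have -> : ell2_norm x = 0 by apply/eqP; rewrite eq_le x0 ell2_norm_ge0.
by rewrite expr0n.
Qed.

Lemma ell2_norm0 : ell2_norm (0 : ell) = 0.
Proof. by rewrite ell2_normE normsq0 sqrtr0. Qed.

(** The optimal weight in [normsqD_weighted] is the ratio of the two norms. *)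
Lemma ell2_normD x y : ell2_norm (x + y) <= ell2_norm x + ell2_norm y.
Proof.
have [x0|x0] := leP (ell2_norm x) 0.
  by rewrite (ell2_norm_eq0 x0) add0r ell2_norm0 add0r.
have [y0|y0] := leP (ell2_norm y) 0.
  by rewrite (ell2_norm_eq0 y0) addr0 ell2_norm0 addr0.
have r0 : 0 < ell2_norm y / ell2_norm x by rewrite divr_gt0.
have := normsqD_weighted x y r0; rewrite -!ell2_norm_sqr invf_div => H.
rewrite -ler_sqr ?nnegrE ?addr_ge0 ?ell2_norm_ge0//; apply: le_trans H _.
rewrite le_eqVlt; apply/orP; left; apply/eqP; field.
by rewrite !gt_eqF.
Qed.

Lemma ell2_normZ c x : ell2_norm (c *: x) = normc c * ell2_norm x.
Proof.
by rewrite !ell2_normE normsqZ sqrtrM ?sqr_ge0// sqrtr_sqr ger0_norm// normc_ge0.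
Qed.

Lemma ell2_normN x : ell2_norm (- x) = ell2_norm x.
Proof. by rewrite !ell2_normE normsqN. Qed.

Lemma ell2_norm_le (M : R) x y : 0 <= M ->
  (ell2_norm x <= M * ell2_norm y) = (normsq x <= M ^+ 2 * normsq y).
Proof.
move=> M0; rewrite -ler_sqr ?nnegrE ?mulr_ge0 ?ell2_norm_ge0//.
by rewrite exprMn !ell2_norm_sqr.
Qed.

(** Twice the real part of the inner product, obtained by polarization. *)
Definition dotr x y : R := normsq (x + y) - normsq x - normsq y.

Lemma dotrC x y : dotr x y = dotr y x.
Proof. by rewrite /dotr (addrC y); ring. Qed.

Lemma normsqD x y : normsq (x + y) = normsq x + dotr x y + normsq y.
Proof. by rewrite /dotr; ring. Qed.

(** The identity
    |x+y+z|^2 + |x|^2 + |y|^2 + |z|^2 = |x+y|^2 + |y+z|^2 + |x+z|^2. *)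
Lemma dotrDl x y z : dotr (x + y) z = dotr x z + dotr y z.
Proof.
have := @eq_normsq_sum [:: (1, x + y + z); (1, x); (1, y); (1, z)]
  [:: (1, x + y); (1, y + z); (1, x + z)].
have rearrange (p a b c d e f : R) : p + (a + (b + c)) = d + (e + f) ->
    p - d - c = f - a - c + (e - b - c) by lra.
rewrite !sum_listE/= => H; apply: rearrange; apply: H.
- by move=> p; rewrite !inE => /or4P[] /eqP ->; exact: ler01.
- by move=> p; rewrite !inE => /or3P[] /eqP ->; exact: ler01.
move=> t; rewrite !sum_listE/= !addfE !normc_sqr.
by case: (val x t) (val y t) (val z t) => [? ?] [? ?] [? ?] /=; ring.
Qed.

Lemma dotr0l y : dotr 0 y = 0.
Proof. by rewrite /dotr add0r normsq0; ring. Qed.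

Lemma dotrNl x y : dotr (- x) y = - dotr x y.
Proof. by have := dotrDl x (- x) y; rewrite subrr dotr0l; lra. Qed.

Lemma dotr_sum (T : Type) (s : seq T) (F : T -> ell) y :
  dotr (\sum_(i <- s) F i) y = \sum_(i <- s) dotr (F i) y.
Proof.
by elim: s => [|i s IH]; rewrite ?big_nil ?dotr0l// !big_cons dotrDl IH.
Qed.

Lemma dotrZ_adj c x y : dotr (c^*%C *: x) y = dotr x (c *: y).
Proof.
have := @eq_normsq_sum [:: (1, c^*%C *: x + y); (1, x); (1, c *: y)]
  [:: (1, c^*%C *: x); (1, y); (1, x + c *: y)].
have rearrange (p a b d e f : R) : p + (a + b) = d + (e + f) ->
    p - d - e = f - a - b by lra.
rewrite !sum_listE/= => H; apply: rearrange; apply: H.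
- by move=> p; rewrite !inE => /or3P[] /eqP ->; exact: ler01.
- by move=> p; rewrite !inE => /or3P[] /eqP ->; exact: ler01.
move=> t; rewrite !sum_listE/= !addfE !scalefE !normc_sqr.
by case: c (val x t) (val y t) => [? ?] [? ?] [? ?] /=; ring.
Qed.

Lemma dotrZl (r : R) x y : 0 <= r -> dotr (r%:C%C *: x) y = r * dotr x y.
Proof.
move=> r0.
have := @eq_normsq_sum [:: (1, r%:C%C *: x + y); (r, x); (r, y)]
  [:: (1, r%:C%C *: x); (1, y); (r, x + y)].
have rearrange (p a b d e f : R) : p + (r * a + r * b) = d + (e + r * f) ->
    p - d - e = r * (f - a - b) by rewrite !mulrBr; lra.
rewrite !sum_listE/= => H; apply: rearrange; apply: H.
- by move=> p; rewrite !inE => /or3P[] /eqP -> //; exact: ler01.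
- by move=> p; rewrite !inE => /or3P[] /eqP -> //; exact: ler01.
move=> t; rewrite !sum_listE/= !addfE !scalefE !normc_sqr.
by case: (val x t) (val y t) => [? ?] [? ?] /=; ring.
Qed.

Lemma normsq_lambda g x : normsq (lambda g x) = normsq x.
Proof. by rewrite /normsq sqnorm_translate. Qed.

Lemma lambda_lin g c x y : lambda g (c *: x + y) = c *: lambda g x + lambda g y.
Proof. exact: val_inj. Qed.

Lemma lambdaM g h x : lambda (g * h)%g x = lambda g (lambda h x).
Proof. by apply/val_inj/funext => t /=; rewrite invgM mulgA. Qed.

Lemma lambda1 x : lambda 1%g x = x.
Proof. by apply/val_inj/funext => t /=; rewrite invg1 mul1g. Qed.

Lemma dotr_lambda g x y : dotr (lambda g x) y = dotr x (lambda g^-1%g y).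
Proof.
set z := lambda g^-1%g y.
have -> : y = lambda g z by rewrite /z -lambdaM mulgV lambda1.
rewrite /dotr; have -> : lambda g x + lambda g z = lambda g (x + z) by exact: val_inj.
by rewrite !normsq_lambda.
Qed.

End SquareNorm.

(** * Operators and norm closures *)

Section Operators.
Variables (R : realType) (G : groupType).
Local Notation ell := (ell2 R G).
Local Notation op := (ell -> ell).
Local Notation normc := ComplexField.Normc.normc.
Implicit Types (x y : ell) (c : R[i]) (a b : op) (M N e : R) (S : set op).

Definition linear_op a := forall c x y, a (c *: x + y) = c *: a x + a y.

Lemma linear_opB a x y : linear_op a -> a (x - y) = a x - a y.
Proof. by move=> la; rewrite addrC -scaleN1r la scaleN1r addrC. Qed.

Lemma op_norm_leD a b M N : op_norm_le a M -> op_norm_le b N ->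
  op_norm_le (a + b) (M + N).
Proof.
move=> aM bN x; apply: le_trans (ell2_normD _ _) _.
by rewrite mulrDl lerD.
Qed.

Lemma op_norm_leZ c a M : op_norm_le a M -> op_norm_le (c *: a) (normc c * M).
Proof.
move=> aM x; rewrite -[(c *: a) x]/(c *: a x) ell2_normZ -mulrA.
by apply: ler_wpM2l; [exact: normc_ge0|exact: aM].
Qed.

Lemma op_norm_leN a M : op_norm_le a M -> op_norm_le (- a) M.
Proof. by move=> aM x; rewrite -[(- a) x]/(- a x) ell2_normN. Qed.

Lemma op_norm_le_comp a b M N : 0 <= M -> op_norm_le a M -> op_norm_le b N ->
  op_norm_le (a \o b) (M * N).
Proof.
move=> M0 aM bN x; apply: le_trans (aM _) _.
by rewrite -mulrA ler_wpM2l.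
Qed.

Lemma op_norm_leW a M N : M <= N -> op_norm_le a M -> op_norm_le a N.
Proof.
move=> MN aM x; apply: le_trans (aM x) _.
by rewrite ler_wpM2r// ell2_norm_ge0.
Qed.

Lemma op_norm_leBC a b M : op_norm_le (a - b) M -> op_norm_le (b - a) M.
Proof. by move/op_norm_leN; rewrite opprB. Qed.

Lemma op_norm_le_trans a b d M N : op_norm_le (a - b) M -> op_norm_le (b - d) N ->
  op_norm_le (a - d) (M + N).
Proof. by move=> ab bd; have := op_norm_leD ab bd; rewrite addrA subrK. Qed.

Lemma op_norm_le0 a : op_norm_le a 0 -> a = 0.
Proof.
by move=> a0; apply/funext => x; apply: ell2_norm_eq0; have := a0 x; rewrite mul0r.
Qed.

Lemma op_norm_le_bounded a : bounded_op a -> exists2 M, 0 <= M & op_norm_le a M.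
Proof.
move=> [K K0 aK]; exists (Num.sqrt K); first exact: sqrtr_ge0.
by apply/op_norm_leP; rewrite ?sqrtr_ge0// sqr_sqrtr.
Qed.

Lemma op_norm_le_small a : (forall e, 0 < e -> op_norm_le a e) -> a = 0.
Proof.
move=> ae; apply: op_norm_le0 => x; rewrite mul0r.
apply/ler_addgt0Pr => e e0; rewrite add0r.
have n1 : 0 < ell2_norm x + 1 by have := ell2_norm_ge0 x; lra.
have := ae (e / (ell2_norm x + 1)) (divr_gt0 e0 n1) x.
move/le_trans; apply; rewrite -mulrA ger_pMr// ler_pdivrMl// mulr1; lra.
Qed.

Lemma norm_closure_sub S : S `<=` norm_closure S.
Proof.
move=> a Sa e e0; exists a => //; rewrite subrr => x.
by rewrite ell2_norm0 mulr_ge0 ?ell2_norm_ge0// ltW.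
Qed.

Lemma norm_closureS S S' : S `<=` S' -> norm_closure S `<=` norm_closure S'.
Proof. by move=> SS' a aS e /aS[b /SS' S'b]; exists b. Qed.

Lemma norm_closure_idem S : norm_closure (norm_closure S) `<=` norm_closure S.
Proof.
move=> a aS e e0; have e20 : 0 < e / 2 by lra.
have [b /(_ _ e20)[d Sd bd] ab] := aS _ e20.
exists d => //; rewrite (splitr e); exact: op_norm_le_trans ab bd.
Qed.

Lemma norm_closure_lin S c :
  (forall a b, S a -> S b -> S (c *: a + b)) ->
  forall a b, norm_closure S a -> norm_closure S b -> norm_closure S (c *: a + b).
Proof.
move=> Slin a b aS bS e e0; have e20 : 0 < e / 2 by lra.
have c0 := normc_ge0 c; have c1 : 0 < normc c + 1 by lra.
have [a' Sa' aa'] := aS (e / 2 / (normc c + 1)) (divr_gt0 e20 c1).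
have [b' Sb' bb'] := bS _ e20.
exists (c *: a' + b'); first exact: Slin.
have -> : c *: a + b - (c *: a' + b') = c *: (a - a') + (b - b').
  by rewrite opprD addrACA scalerBr.
rewrite [e]splitr; apply: op_norm_leD => //.
apply: op_norm_leW (op_norm_leZ c aa').
by rewrite mulrA mulrAC ger_pMl// ler_pdivrMr// mul1r; lra.
Qed.

Lemma norm_closure_linear_op S : (forall a, S a -> linear_op a) ->
  forall a, norm_closure S a -> linear_op a.
Proof.
move=> Slin a aS c x y; apply/eqP; rewrite -subr_eq0; apply/eqP.
apply: ell2_norm_eq0; apply/ler_addgt0Pr => e e0; rewrite add0r.
pose k := ell2_norm (c *: x + y) + normc c * ell2_norm x + ell2_norm y.
have k0 : 0 <= k by rewrite !addr_ge0 ?mulr_ge0 ?ell2_norm_ge0 ?normc_ge0.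
have k1 : 0 < k + 1 by lra.
have [b Sb ab] := aS _ (divr_gt0 e0 k1).
have -> : a (c *: x + y) - (c *: a x + a y) =
    (a - b) (c *: x + y) + (- (c *: (a - b) x) - (a - b) y).
  rewrite -![(a - b) _]/(a _ - b _) (Slin b Sb) scalerBr !opprB !opprD.
  rewrite [RHS]addrACA; rewrite -!addrA; congr (_ + _).
  rewrite [RHS]addrCA; congr (_ + _); rewrite !addrA.
  by rewrite subrr sub0r addNr sub0r.
have H1 := ab (c *: x + y); have H2 := ab x; have H3 := ab y.
apply: le_trans (ell2_normD _ _) _.
apply: le_trans (lerD H1 (ell2_normD _ _)) _.
rewrite !ell2_normN ell2_normZ.
have {}H2 := ler_wpM2l (normc_ge0 c) H2.
apply: (@le_trans _ _ (e / (k + 1) * k)).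
  by rewrite /k; lra.
by rewrite -mulrA ger_pMr// ler_pdivrMl// mulr1; lra.
Qed.

Lemma norm_closure_comp S : (forall a, S a -> linear_op a) ->
  (forall a, S a -> bounded_op a) -> (forall a b, S a -> S b -> S (a \o b)) ->
  forall a b, norm_closure S a -> norm_closure S b -> norm_closure S (a \o b).
Proof.
move=> Slin Sb SM a b aS bS.
have lina := norm_closure_linear_op Slin aS.
have bounded d : norm_closure S d -> exists2 M, 0 <= M & op_norm_le d M.
  move=> /(_ 1 ltr01)[d' /Sb /op_norm_le_bounded[M M0 d'M] dd'].
  exists (1 + M); first by lra.
  by have := op_norm_leD dd' d'M; rewrite subrK.
have [M M0 aM] := bounded a aS.
move=> e e0; have e20 : 0 < e / 2 by lra.
have M1 : 0 < M + 1 by lra.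
have [b' Sb' bb'] := bS _ (divr_gt0 e20 M1).
have [M' M'0 b'M] := op_norm_le_bounded (Sb _ Sb').
have M'1 : 0 < M' + 1 by lra.
have [a' Sa' aa'] := aS _ (divr_gt0 e20 M'1).
exists (a' \o b'); first exact: SM.
have -> : (a \o b) - (a' \o b') = (a \o (b - b')) + ((a - a') \o b').
  apply/funext => x; rewrite -[LHS]/(a (b x) - a' (b' x)).
  rewrite -[RHS]/(a (b x - b' x) + (a (b' x) - a' (b' x))).
  by rewrite (linear_opB (b x) (b' x) lina) addrA subrK.
rewrite [e]splitr; apply: op_norm_leD.
  apply: op_norm_leW (op_norm_le_comp M0 aM bb').
  by rewrite mulrCA ger_pMr// ler_pdivrMr// mul1r; lra.
apply: op_norm_leW (op_norm_le_comp _ aa' b'M); last by rewrite divr_ge0 ?ltW.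
by rewrite -mulrA ger_pMr// ler_pdivrMl// mulr1; lra.
Qed.
End Operators.

(** * The group algebra and its closure *)

Section GroupAlgebra.
Variables (R : realType) (G : groupType) (H : set G).
Hypotheses (H1 : H 1%g) (HM : forall g h, H g -> H h -> H (g * h)%g).
Local Notation ell := (ell2 R G).
Local Notation op := (ell -> ell).
Local Notation A := (cstar_r R H).
Implicit Types (a b : op) (c : R[i]) (g h : G).

Lemma group_algebra_ind (K : op -> Prop) :
  K 0 -> (forall c g a, H g -> K a -> K (c *: lambda g + a)) ->
  forall a, group_algebra H a -> K a.
Proof.
move=> K0 KD a [s [c [sH ->]]]; elim: s sH => [_|g s IH sH].
  by rewrite big_nil.
rewrite big_cons; apply: KD; first by apply: sH; rewrite inE eqxx.
by apply: IH => h content_has_sup; apply: sH; rewrite inE content_has_sup orbT.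
Qed.

(** A family may list a group element several times with different coefficients,
    whereas [group_algebra] allows one coefficient per element; repetitions are
    collected. *)
Lemma group_algebra_family (s : seq (R[i] * G)) : (forall p, p \in s -> H p.2) ->
  @group_algebra R G H (\sum_(p <- s) p.1 *: lambda p.2).
Proof.
move=> sH; pose u := undup [seq p.2 | p <- s].
exists u, (fun g => \sum_(p <- s | p.2 == g) p.1); split.
  by move=> g; rewrite mem_undup => /mapP[p /sH + ->].
transitivity (\sum_(g <- u) \sum_(p <- s | p.2 == g) p.1 *: @lambda R G p.2).
  rewrite (exchange_big_dep xpredT)//= big_seq [RHS]big_seq.
  apply: eq_bigr => p ps; rewrite (big_rem p.2)/=; last first.
    by rewrite mem_undup map_f.
  rewrite eqxx big_seq_cond big1 ?addr0// => g /andP[gu /eqP pg].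
  by move: gu; rewrite mem_rem_uniq ?undup_uniq// inE pg eqxx.
apply: eq_bigr => g _; rewrite scaler_suml; apply: eq_bigr => p /eqP <- //.
Qed.

Lemma group_algebraP a : group_algebra H a ->
  exists2 s : seq (R[i] * G), (forall p, p \in s -> H p.2) &
    a = \sum_(p <- s) p.1 *: lambda p.2.
Proof.
move=> [s [c [sH ->]]]; exists [seq (c g, g) | g <- s].
  by move=> _ /mapP[g /sH Hg ->].
by rewrite big_map.
Qed.

Lemma group_algebra_lin c a b : group_algebra H a -> group_algebra H b ->
  group_algebra H (c *: a + b).
Proof.
move=> /group_algebraP[s sH ->] /group_algebraP[t tH ->].
rewrite scaler_sumr; under eq_bigr do rewrite scalerA.
rewrite -[X in X + _](big_map (fun p => (c * p.1, p.2)) xpredT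
  (fun p => p.1 *: @lambda R G p.2)) -big_cat; apply: group_algebra_family.
by move=> p; rewrite mem_cat => /orP[/mapP[q /sH ? ->]|/tH].
Qed.

Lemma group_algebra0 : @group_algebra R G H 0.
Proof. by exists [::], (fun=> 0); split => //; rewrite big_nil. Qed.

Lemma group_algebra_lambda g : H g -> @group_algebra R G H (lambda g).
Proof.
move=> Hg; exists [:: g], (fun=> 1); split; first by move=> h; rewrite inE => /eqP ->.
by rewrite big_seq1 scale1r.
Qed.

Lemma linear_lambda g : linear_op (@lambda R G g).
Proof. exact: lambda_lin. Qed.

Lemma linear_opD a b : linear_op a -> linear_op b -> linear_op (a + b).
Proof.
move=> la lb c x y; rewrite -![(a + b) _]/(a _ + b _) la lb scalerDr.
by rewrite addrACA.
Qed.

Lemma linear_opZ c a : linear_op a -> linear_op (c *: a).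
Proof.
move=> la k x y; rewrite -![(c *: a) _]/(c *: a _) la scalerDr !scalerA.
by rewrite mulrC.
Qed.

Lemma linear_op0 : linear_op (0 : op).
Proof.
by move=> c x y; rewrite -![(0 : op) _]/(0 : ell) scaler0 addr0.
Qed.

Lemma group_algebra_linear_op a : group_algebra H a -> linear_op a.
Proof.
apply: (@group_algebra_ind (@linear_op R G)); first exact: linear_op0.
by move=> c g b _ lb; apply: linear_opD => //; exact/linear_opZ/linear_lambda.
Qed.

Lemma lambda_comp g h : lambda g \o lambda h = @lambda R G (g * h)%g.
Proof. by apply/funext => x; rewrite lambdaM. Qed.

Lemma lambda1_id : @lambda R G 1%g = id.
Proof. by apply/funext => x; rewrite lambda1. Qed.

Lemma comp_addl a b d : (a + b) \o d = (a \o d : op) + (b \o d : op). Proof. by []. Qed.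
Lemma comp_scalel c a d : (c *: a) \o d = c *: (a \o d : op). Proof. by []. Qed.

Lemma comp_linr c a b d : linear_op d -> d \o (c *: a + b) = c *: (d \o a : op) + (d \o b : op).
Proof. by move=> ld; apply/funext => x; exact: ld. Qed.

Lemma linear_op_0 a : linear_op a -> a 0 = 0.
Proof. by move=> la; have := la (-1) 0 0; rewrite scaler0 addr0 scaleN1r addNr. Qed.

Lemma group_algebraM a b : group_algebra H a -> group_algebra H b ->
  group_algebra H (a \o b).
Proof.
move=> + gb; apply: (group_algebra_ind (K := fun a => group_algebra H (a \o b))).
  exact: group_algebra0.
move=> c g {}a Hg IH; rewrite comp_addl comp_scalel; apply: group_algebra_lin => //.
move: gb; apply: (group_algebra_ind (K := fun b => group_algebra H (lambda g \o b))).
  have -> : lambda g \o (0 : op) = 0 by apply/funext => x; exact: linear_op_0 (linear_lambda g).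
  exact: group_algebra0.
move=> k h d Hh IHd; rewrite comp_linr; last exact: linear_lambda.
apply: group_algebra_lin => //; rewrite lambda_comp.
exact/group_algebra_lambda/HM.
Qed.

Lemma cstar_linear_op a : A a -> linear_op a.
Proof. by apply: norm_closure_linear_op => b; exact: group_algebra_linear_op. Qed.

Lemma cstar_lin c a b : A a -> A b -> A (c *: a + b).
Proof. by apply: norm_closure_lin => a' b'; exact: group_algebra_lin. Qed.

Lemma cstarM a b : A a -> A b -> A (a \o b).
Proof.
apply: norm_closure_comp => [d|d|d d'].
- exact: group_algebra_linear_op.
- exact: group_algebra_bounded.
- exact: group_algebraM.
Qed.

Lemma group_algebra_cstar a : group_algebra H a -> A a.
Proof. exact: norm_closure_sub. Qed.

Lemma cstar_closed : norm_closure A `<=` A.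
Proof. exact: norm_closure_idem. Qed.

Lemma cstar_lambda g : H g -> A (lambda g).
Proof. by move=> Hg; exact/group_algebra_cstar/group_algebra_lambda. Qed.

Lemma cstar0 : A 0.
Proof. exact/group_algebra_cstar/group_algebra0. Qed.

Lemma cstar_id : A id.
Proof. by rewrite -lambda1_id; exact: cstar_lambda. Qed.

Lemma cstar_norm_le a : A a -> exists2 M, 0 <= M & op_norm_le a M.
Proof. by move=> Aa; exact/op_norm_le_bounded/(cstar_r_bounded Aa). Qed.

Lemma cstar_sub_full : A `<=` cstar_r R [set: G].
Proof. by apply: norm_closureS => a; exact: group_algebra_sub. Qed.
End GroupAlgebra.

(** * Proper ideals and maximal ideals *)

Section Ideals.
Variables (R : realType) (G : groupType) (H : set G).
Hypotheses (H1 : H 1%g) (HM : forall g h, H g -> H h -> H (g * h)%g).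
Local Notation ell := (ell2 R G).
Local Notation op := (ell -> ell).
Local Notation A := (cstar_r R H).
Implicit Types (a b : op) (c : R[i]) (I J K : set op).

Lemma ideal_full I : ideal A I -> I id -> I = A.
Proof.
move=> [IA _ _ Imul _] I1; apply/seteqP; split => // a Aa.
by have [+ _] := Imul a id Aa I1.
Qed.

(** With [d := id - j], every [id - d ^ n] is in [I], and [d ^ n] tends to 0. *)
Lemma ideal_neumann I j (r : R) : ideal A I -> I j -> r < 1 ->
  op_norm_le (id - j) r -> I = A.
Proof.
move=> II Ij r1 jr; have [IA I0 Ilin Imul Icl] := II; apply: ideal_full => //.
pose r' := Num.max r 0.
have r'0 : 0 <= r' by rewrite le_max lexx orbT.
have r'1 : r' < 1 by rewrite gt_max r1 ltr01.
have {}jr : op_norm_le (id - j) r' by apply: op_norm_leW jr; rewrite le_max lexx.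
pose d n := iter n (fun b : op => (id - j : op) \o b) id.
have dS n : d n.+1 = (id - j : op) \o d n by [].
have Aj : A (id - j : op).
  rewrite addrC -scaleN1r; apply: cstar_lin; [exact: IA|exact: cstar_id].
have Ad n : A (d n).
  elim: n => [|n IH]; first exact: cstar_id.
  rewrite dS; exact: cstarM.
have Id n : I (id - d n).
  elim: n => [|n IH]; first by rewrite /d/= subrr.
  rewrite dS; have [Ijd _] := Imul _ _ (Ad n) Ij; have [_ Ijd'] := Imul _ _ (Ad n) Ij.
  have -> : id - ((id - j : op) \o d n) = 1 *: (id - d n) + (j \o d n).
    rewrite scale1r; apply/funext => x.
    rewrite -[LHS]/(x - (d n x - j (d n x))) -[RHS]/(x - d n x + j (d n x)).
    by rewrite opprB addrA addrAC.
  exact: Ilin.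
have dn n : op_norm_le (d n) (r' ^+ n).
  elim: n => [|n IH]; first by move=> x; rewrite mul1r.
  by rewrite exprS dS; exact: op_norm_le_comp.
apply: Icl => e e0.
have [n rn] : exists n, r' ^+ n <= e.
  have : (GRing.exp r' : R^nat) @ \oo --> 0.
    by apply: cvg_expr; rewrite ger0_norm.
  move=> /cvgrPdist_le /(_ e e0)[n _ /(_ n (leqnn n)) /=].
  rewrite sub0r normrN => rn; exists n.
  exact: le_trans (ler_norm _) _.
exists (id - d n) => //.
by rewrite opprB addrCA subrr addr0; exact: op_norm_leW (dn n).
Qed.

(* The union of a chain of ideals need not be closed.  Closedness is replaced by
   having distance at least 1 from the identity, which passes to unions and to
   closures and which proper ideals have by [ideal_neumann]. *)
Let pre_ideal I :=
  [/\ I `<=` A, forall c a b, I a -> I b -> I (c *: a + b),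
      forall a b, A a -> I b -> I (a \o b) /\ I (b \o a)
    & forall j r, I j -> r < 1 -> ~ op_norm_le (id - j) r].

Let pre_ideal_closure I : pre_ideal I -> pre_ideal (norm_closure I).
Proof.
move=> [IA Ilin Imul Idist]; split.
- apply: subset_trans (norm_closureS IA) _; exact: cstar_closed.
- by move=> c; apply: norm_closure_lin; exact: Ilin.
- move=> a b Aa clb; have [M M0 aM] := cstar_norm_le Aa.
  have M1 : 0 < M + 1 by lra.
  have bA : A b by apply: cstar_closed; exact: norm_closureS clb.
  split=> e e0; have [b' Ib' bb'] := clb _ (divr_gt0 e0 M1).
  - exists (a \o b'); first by have [] := Imul a b' Aa Ib'.
    have -> : (a \o b) - (a \o b') = a \o (b - b').
      apply/funext => x; rewrite -[RHS]/(a (b x - b' x)).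
      by rewrite (linear_opB (b x) (b' x) (cstar_linear_op Aa)).
    apply: op_norm_leW (op_norm_le_comp M0 aM bb').
    by rewrite mulrCA ger_pMr// ler_pdivrMr// mul1r; lra.
  - exists (b' \o a); first by have [] := Imul a b' Aa Ib'.
    have -> : (b \o a) - (b' \o a) = (b - b') \o a by [].
    apply: op_norm_leW (op_norm_le_comp _ bb' aM); last by rewrite divr_ge0 ?ltW.
    by rewrite -mulrA ger_pMr// ler_pdivrMl// mulr1; lra.
- move=> j r clj r1 jr; have s0 : 0 < (1 - r) / 2 by lra.
  have [j' Ij' jj'] := clj _ s0.
  apply: (Idist j' (r + (1 - r) / 2) Ij'); first by lra.
  exact: op_norm_le_trans jr jj'.
Qed.

Lemma maximal_ideal_exists K : ideal A K -> K <> A ->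
  exists2 I, maximal_ideal A I & K `<=` I.
Proof.
move=> KI KA.
have preP J : ideal A J -> J <> A -> pre_ideal J.
  move=> JI JA; have [? ? ? ? ?] := JI; split => // j r Jj r1 jr.
  exact: JA (ideal_neumann JI Jj r1 jr).
have K0 : K 0 by case: KI.
(* The empty set is admitted for the sake of the empty chain. *)
pose P I := I = set0 \/ pre_ideal I /\ K `<=` I.
have [] := @Zorn_bigcup op P.
  move=> F FP Ftot; set U := \bigcup_(X in F) X.
  have [[X0 FX0 [a0 X0a0]]|nF] := pselect (exists2 X, F X & X !=set0); last first.
    left; rewrite -subset0 => a [X FX Xa]; apply: nF; exists X => //.
    by exists a.
  have FQ X a : F X -> X a -> pre_ideal X /\ K `<=` X.
    by move=> FX Xa; have [X0'|//] := FP X FX; move: Xa; rewrite X0'.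
  right; split; last first.
    by move=> a Ka; exists X0 => //; have [_] := FQ _ _ FX0 X0a0; exact.
  split.
  - by move=> a [X FX Xa]; have [[+ _ _ _] _] := FQ _ _ FX Xa; exact.
  - move=> c a b [X FX Xa] [Y FY Yb].
    have [XY|YX] := Ftot X Y FX FY.
      exists Y => //; have [[_ + _ _] _] := FQ _ _ FY Yb; apply => //.
      exact: XY.
    exists X => //; have [[_ + _ _] _] := FQ _ _ FX Xa; apply => //.
    exact: YX.
  - move=> a b Aa [X FX Xb]; have [[_ _ + _] _] := FQ _ _ FX Xb.
    by move=> /(_ a b Aa Xb)[? ?]; split; exists X.
  - by move=> j r [X FX Xj]; have [[_ _ _ +] _] := FQ _ _ FX Xj; exact.
move=> I [PI Imax].
have [I0|[preI KsubI]] := PI.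
  exfalso; apply: (Imax K); last by right; split => //; exact: preP.
  by split; [rewrite I0; exact: sub0set|move=> /(_ 0 K0); rewrite I0].
have max J : pre_ideal J -> I `<=` J -> J = I.
  move=> preJ IJ; apply: contrapT => JI; apply: (Imax J).
    by split => // JI'; apply: JI; apply/seteqP.
  by right; split => //; exact: subset_trans IJ.
have clI : norm_closure I = I.
  by apply: max; [exact: pre_ideal_closure|exact: norm_closure_sub].
have II : ideal A I.
  have [IA Ilin Imul _] := preI; split => //; first exact: KsubI.
  by rewrite clI.
exists I => //; split => //.
  move=> IA; have [_ _ _ /(_ id 0)] := preI; apply => //.
    by rewrite IA; exact: cstar_id.
  by rewrite subrr => x; rewrite mul0r -[(0 : op) x]/(0 : ell) ell2_norm0.
by move=> J JI JA IJ; apply: max => //; exact: preP.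
Qed.
End Ideals.

(** * The conditional expectation is a bimodule map *)

Section ConditionalExpectation.
Variables (R : realType) (G : groupType) (H : set G).
Hypotheses (H1 : H 1%g) (HM : forall g h, H g -> H h -> H (g * h)%g)
  (HV : forall g, H g -> H g^-1%g).
Local Notation ell := (ell2 R G).
Local Notation op := (ell -> ell).
Local Notation A := (cstar_r R [set: G]).
Local Notation B := (cstar_r R H).
Local Notation P := (@cond_exp R G H).
Implicit Types (a b x y : op) (c : R[i]) (I J K : set op).

Let TM : forall g h : G, setT g -> setT h -> [set: G] (g * h)%g. Proof. by []. Qed.
Let hP : is_cond_exp H P. Proof. exact: cond_expP. Qed.

Lemma cond_exp_cstar a : A a -> B (P a).
Proof. by case: hP => h _ _ _ _ Aa; exact: h Aa. Qed.

Lemma cond_exp_lin c a b : A a -> A b -> P (c *: a + b) = c *: P a + P b.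
Proof. by case: hP => _ h _ _ _ Aa Ab; exact: h Aa Ab. Qed.

Lemma cond_exp_norm a (M : R) : A a -> op_norm_le a M -> op_norm_le (P a) M.
Proof. by case: hP => _ _ h _ _ Aa aM; exact: h Aa aM. Qed.

Lemma cond_exp_fix b : B b -> P b = b.
Proof. by case: hP => _ _ _ h _ Bb; exact: h Bb. Qed.

Lemma cond_exp_lambda g :
  P (lambda g) = if `[< H g >] then lambda g else 0.
Proof. by have [_ _ _ _ /(_ g)[h1 h2]] := hP; case: asboolP. Qed.

Lemma cond_exp0 : P 0 = 0.
Proof. by apply: cond_exp_fix; exact: cstar0. Qed.

Lemma cond_expB a b : A a -> A b -> P (a - b) = P a - P b.
Proof.
by move=> Aa Ab; rewrite addrC -scaleN1r cond_exp_lin// scaleN1r addrC.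
Qed.

Let AM a b : A a -> A b -> A (a \o b). Proof. exact (@cstarM R G setT TM a b). Qed.

Let AB a b : A a -> A b -> A (a - b).
Proof. by move=> Aa Ab; rewrite addrC -scaleN1r; exact: cstar_lin. Qed.

(** Two maps that are Lipschitz along the approximation of points of the closure
    by points of [S] and agree on [S] agree on the closure. *)
Lemma closure_eq (S : set op) (F F' : op -> op) (M : R) : 0 <= M ->
  (forall a b e, norm_closure S a -> S b -> 0 <= e ->
     op_norm_le (a - b) e -> op_norm_le (F a - F b) (M * e)) ->
  (forall a b e, norm_closure S a -> S b -> 0 <= e ->
     op_norm_le (a - b) e -> op_norm_le (F' a - F' b) (M * e)) ->
  (forall a, S a -> F a = F' a) -> forall a, norm_closure S a -> F a = F' a.
Proof.
move=> M0 FM FM' FF a aS; apply/eqP; rewrite -subr_eq0; apply/eqP.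
apply: op_norm_le_small => e e0.
have M1 : 0 < 2 * M + 1 by lra.
have e1 : 0 < e / (2 * M + 1) by rewrite divr_gt0.
have [b Sb ab] := aS _ e1.
have h1 := FM a b _ aS Sb (ltW e1) ab.
have h2 := FM' a b _ aS Sb (ltW e1) ab.
rewrite (FF b Sb) in h1; have := op_norm_le_trans h1 (op_norm_leBC h2).
apply: op_norm_leW; rewrite mulrCA -mulrDr ger_pMr//.
by rewrite -mulrDl ler_pdivrMr// mul1r; lra.
Qed.

Let compBr a b d : linear_op d -> (d \o a) - (d \o b) = d \o (a - b).
Proof.
move=> ld; apply/funext => x; rewrite -[RHS]/(d (a x - b x)).
by rewrite (linear_opB (a x) (b x) ld).
Qed.

Let compBl a b d : (a \o d : op) - (b \o d) = ((a - b) \o d : op). Proof. by []. Qed.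

Lemma cond_exp_lambda_comp h a : H h -> A a ->
  P (lambda h \o a) = lambda h \o P a /\ P (a \o lambda h) = P a \o lambda h.
Proof.
move=> Hh.
have lh : linear_op (@lambda R G h) by exact: linear_lambda.
have Ah : A (lambda h) by exact: cstar_lambda.
have nh : op_norm_le (@lambda R G h) 1.
  by move=> x; rewrite mul1r !ell2_normE normsq_lambda.
have Hl g : `[< H (h * g)%g >] = `[< H g >].
  apply: asbool_equiv_eq; split => Hg; last exact: HM.
  by rewrite -(mulKg h g); apply: HM => //; exact: HV.
have Hr g : `[< H (g * h)%g >] = `[< H g >].
  apply: asbool_equiv_eq; split => Hg; last exact: HM.
  by rewrite -(mulgK h g); apply: HM => //; exact: HV.
have z1 : lambda h \o (0 : op) = 0 by apply/funext => x; exact: linear_op_0 lh.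
have gaA b : group_algebra setT b -> A b by exact: group_algebra_cstar.
move=> Aa; split; move: a Aa; apply: (closure_eq (M := 1)) => //.
- move=> a b e Aa /gaA Ab e0 ab; rewrite mul1r.
  have Aha := AM Ah Aa.
  have Ahb := AM Ah Ab.
  rewrite -(cond_expB Aha Ahb) (compBr a b lh).
  apply: (cond_exp_norm (AM Ah (AB Aa Ab))).
  by rewrite -[e]mul1r; apply: op_norm_le_comp.
- move=> a b e Aa /gaA Ab e0 ab.
  rewrite (compBr _ _ lh) -(cond_expB Aa Ab); apply: op_norm_le_comp => //.
  exact: (cond_exp_norm (AB Aa Ab)).
- move=> a ga; suff [] : A a /\ P (lambda h \o a) = lambda h \o P a by [].
  move: a ga; apply: group_algebra_ind.
    by rewrite cond_exp0 z1 cond_exp0; split => //; exact: cstar0.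
  move=> c g a _ [Aa IH].
  have Ag : A (lambda g) by exact: cstar_lambda.
  split; first exact: cstar_lin.
  rewrite (comp_linr _ _ _ lh) lambda_comp.
  have Ahg : A (lambda (h * g)%g) by exact: cstar_lambda.
  have Aha := AM Ah Aa.
  rewrite (cond_exp_lin c Ahg Aha) (cond_exp_lin c Ag Aa) (comp_linr _ _ _ lh) IH.
  congr (_ *: _ + _); rewrite !cond_exp_lambda Hl.
  by case: ifP => _; rewrite ?lambda_comp.
- move=> a b e Aa /gaA Ab e0 ab; rewrite mul1r.
  have Aha := AM Aa Ah.
  have Ahb := AM Ab Ah.
  rewrite -(cond_expB Aha Ahb) compBl.
  apply: (cond_exp_norm (AM (AB Aa Ab) Ah)).
  by rewrite -[e]mulr1; apply: op_norm_le_comp.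
- move=> a b e Aa /gaA Ab e0 ab.
  rewrite compBl -(cond_expB Aa Ab) mulrC; apply: op_norm_le_comp => //.
  exact: (cond_exp_norm (AB Aa Ab)).
- move=> a ga; suff [] : A a /\ P (a \o lambda h) = P a \o lambda h by [].
  move: a ga; apply: group_algebra_ind.
    have z2 : (0 : op) \o @lambda R G h = (0 : op) by [].
    by rewrite z2 !cond_exp0; split; [exact: cstar0|rewrite z2].
  move=> c g a _ [Aa IH].
  have Ag : A (lambda g) by exact: cstar_lambda.
  split; first exact: cstar_lin.
  rewrite comp_addl comp_scalel lambda_comp.
  have Ahg : A (lambda (g * h)%g) by exact: cstar_lambda.
  have Aha := AM Aa Ah.
  rewrite (cond_exp_lin c Ahg Aha) (cond_exp_lin c Ag Aa) comp_addl comp_scalel IH.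
  congr (_ *: _ + _); rewrite !cond_exp_lambda Hr.
  by case: ifP => _; rewrite ?lambda_comp.
Qed.

(** On [lambda h] and [lambda g] this says that [h * g] is in [H] iff [g] is.  The
    first approximation extends it to all [a] for fixed [h], the second one to all
    [b] for fixed [a]. *)
Lemma cond_exp_bimodule b a : B b -> A a ->
  P (b \o a) = b \o P a /\ P (a \o b) = P a \o b.
Proof.
move=> Bb Aa.
have [M M0 aM] := cstar_norm_le Aa.
have la := cstar_linear_op Aa.
have BA d : B d -> A d by exact: cstar_sub_full.
have gaA d : group_algebra H d -> A d.
  by move=> /group_algebra_sub; exact: group_algebra_cstar.
have APa : A (P a) by exact/BA/cond_exp_cstar.
have lPa := cstar_linear_op APa.
have PaM : op_norm_le (P a) M by exact: cond_exp_norm.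
split; move: b Bb; apply: (closure_eq M0).
- move=> b d e /BA Ab /gaA Ad e0 bd.
  have Aba := AM Ab Aa.
  have Ada := AM Ad Aa.
  rewrite -(cond_expB Aba Ada) compBl.
  apply: (cond_exp_norm (AM (AB Ab Ad) Aa)).
  by rewrite mulrC; apply: op_norm_le_comp.
- move=> b d e _ _ e0 bd; rewrite compBl mulrC.
  exact: op_norm_le_comp.
- move=> b gb; suff [] : A (b \o a) /\ P (b \o a) = b \o P a by [].
  move: b gb; apply: group_algebra_ind.
    have z d : (0 : op) \o d = (0 : op) by [].
    by rewrite !z cond_exp0; split => //; exact: cstar0.
  move=> c h b Hh [Aba IH]; have Ah : A (lambda h) by exact: cstar_lambda.
  have Aha := AM Ah Aa.
  rewrite comp_addl comp_scalel; split; first exact: cstar_lin.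
  rewrite (cond_exp_lin c Aha Aba) IH.
  by rewrite (cond_exp_lambda_comp Hh Aa).1.
- move=> b d e /BA Ab /gaA Ad e0 bd.
  have Aba := AM Aa Ab.
  have Ada := AM Aa Ad.
  rewrite -(cond_expB Aba Ada) (compBr _ _ la).
  apply: (cond_exp_norm (AM Aa (AB Ab Ad))).
  exact: op_norm_le_comp.
- by move=> b d e _ _ e0 bd; rewrite (compBr _ _ lPa); apply: op_norm_le_comp.
- move=> b gb; suff [] : A (a \o b) /\ P (a \o b) = P a \o b by [].
  move: b gb; apply: group_algebra_ind.
    have -> : a \o (0 : op) = 0 by apply/funext => x; exact: linear_op_0 la.
    have -> : P a \o (0 : op) = 0 by apply/funext => x; exact: linear_op_0 lPa.
    by split; [exact: cstar0|exact: cond_exp0].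
  move=> c h b Hh [Aba IH]; have Ah : A (lambda h) by exact: cstar_lambda.
  have Aha := AM Aa Ah.
  rewrite (comp_linr _ _ _ la) (comp_linr _ _ _ lPa); split; first exact: cstar_lin.
  rewrite (cond_exp_lin c Aha Aba) IH.
  by rewrite (cond_exp_lambda_comp Hh Aa).2.
Qed.

End ConditionalExpectation.

(** * Induced and co-induced ideals *)

Section Induction.
Variables (R : realType) (G : groupType) (H : set G).
Hypotheses (H1 : H 1%g) (HM : forall g h, H g -> H h -> H (g * h)%g)
  (HV : forall g, H g -> H g^-1%g).
Local Notation ell := (ell2 R G).
Local Notation op := (ell -> ell).
Local Notation A := (cstar_r R [set: G]).
Local Notation B := (cstar_r R H).
Local Notation P := (@cond_exp R G H).
Implicit Types (a b x y : op) (c : R[i]) (I J K : set op).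

Let TM : forall g h : G, setT g -> setT h -> [set: G] (g * h)%g. Proof. by []. Qed.

Let AM a b : A a -> A b -> A (a \o b).
Proof. exact (@cstarM R G setT TM a b). Qed.

Let AB a b : A a -> A b -> A (a - b).
Proof. by move=> Aa Ab; rewrite addrC -scaleN1r; exact: cstar_lin. Qed.

Let Aid : A id. Proof. exact (@cstar_id R G setT Logic.I). Qed.

Let BA b : B b -> A b. Proof. exact: cstar_sub_full. Qed.

Lemma Ind_ideal I : ideal B I -> ideal A (Ind H I).
Proof.
move=> [IB I0 Ilin Imul Icl]; split.
- by move=> b [].
- split; first exact: cstar0.
  move=> x y Ax Ay.
  have -> : x \o (0 : op) \o y = 0.
    by apply/funext => z; exact: linear_op_0 (cstar_linear_op Ax).
  by rewrite cond_exp0.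
- move=> c a b [Aa Ia] [Ab Ib]; split; first exact: cstar_lin.
  move=> x y Ax Ay.
  have -> : x \o (c *: a + b) \o y = c *: (x \o a \o y : op) + (x \o b \o y : op).
    by apply/funext => z; exact: (cstar_linear_op Ax).
  rewrite (cond_exp_lin H1 HM HV c (AM (AM Ax Aa) Ay) (AM (AM Ax Ab) Ay)).
  exact: Ilin (Ia _ _ Ax Ay) (Ib _ _ Ax Ay).
- move=> a b Aa [Ab Ib]; split; split; [exact: AM Aa Ab| |exact: AM Ab Aa|].
    by move=> x y Ax Ay; exact: Ib (AM Ax Aa) Ay.
  by move=> x y Ax Ay; exact: Ib Ax (AM Aa Ay).
- move=> b clb.
  have Ab : A b.
    by apply: cstar_closed => e e0; have [b' [Ab' _] bb'] := clb e e0; exists b'.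
  split; first exact: Ab.
  move=> x y Ax Ay; apply: Icl => e e0.
  have [M M0 xM] := cstar_norm_le Ax; have [N N0 yN] := cstar_norm_le Ay.
  have MN1 : 0 < M * N + 1 by rewrite ltr_wpDl ?mulr_ge0.
  have [b' [Ab' Ib'] bb'] := clb _ (divr_gt0 e0 MN1).
  exists (P (x \o b' \o y)); first exact: Ib'.
  rewrite -(cond_expB H1 HM HV (AM (AM Ax Ab) Ay) (AM (AM Ax Ab') Ay)).
  have -> : (x \o b \o y) - (x \o b' \o y) = x \o (b - b') \o y.
    apply/funext => z; rewrite -[RHS]/(x (b (y z) - b' (y z))).
    by rewrite (linear_opB (b (y z)) (b' (y z)) (cstar_linear_op Ax)).
  apply: (cond_exp_norm H1 HM HV (AM (AM Ax (AB Ab Ab')) Ay)).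
  have eMN : 0 <= e / (M * N + 1) by rewrite divr_ge0 ?ltW.
  have := op_norm_le_comp (mulr_ge0 M0 eMN) (op_norm_le_comp M0 xM bb') yN.
  apply: op_norm_leW; rewrite mulrAC mulrCA ger_pMr//.
  by rewrite ler_pdivrMr// mul1r; lra.
Qed.

Lemma Coind_ideal J : ideal A J -> ideal B (Coind H J).
Proof.
move=> [JA J0 Jlin Jmul Jcl].
have PB j : J j -> B (P j) by move=> /JA; exact: cond_exp_cstar.
split.
- move=> b clb; apply: cstar_closed => e e0.
  by have [_ [j Jj <-] bj] := clb e e0; exists (P j); [exact: PB|exact: bj].
- by apply: norm_closure_sub; exists 0 => //; exact: cond_exp0.
- move=> c; apply: norm_closure_lin => _ _ [i Ji <-] [j Jj <-].
  exists (c *: i + j); first exact: Jlin.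
  by rewrite (cond_exp_lin H1 HM HV c (JA _ Ji) (JA _ Jj)).
- move=> b d Bb cld; have [M M0 bM] := cstar_norm_le Bb.
  have M1 : 0 < M + 1 by lra.
  split=> e e0; have [_ [j Jj <-] dj] := cld _ (divr_gt0 e0 M1).
    exists (P (b \o j)); first by exists (b \o j) => //; have [] := Jmul b j (BA Bb) Jj.
    rewrite (cond_exp_bimodule H1 HM HV Bb (JA _ Jj)).1.
    have -> : (b \o d) - (b \o P j) = b \o (d - P j).
      apply/funext => z; rewrite -[RHS]/(b (d z - P j z)).
      by rewrite (linear_opB (d z) (P j z) (cstar_linear_op Bb)).
    apply: op_norm_leW (op_norm_le_comp M0 bM dj).
    by rewrite mulrCA ger_pMr// ler_pdivrMr// mul1r; lra.
  exists (P (j \o b)); first by exists (j \o b) => //; have [] := Jmul b j (BA Bb) Jj.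
  rewrite (cond_exp_bimodule H1 HM HV Bb (JA _ Jj)).2.
  have -> : (d \o b) - (P j \o b) = (d - P j) \o b by [].
  apply: op_norm_leW (op_norm_le_comp _ dj bM); last by rewrite divr_ge0 ?ltW.
  by rewrite -mulrA ger_pMr// ler_pdivrMl// mulr1; lra.
- exact: norm_closure_idem.
Qed.

Lemma Ind_proper I : ideal B I -> I <> B -> Ind H I <> A.
Proof.
move=> II IB IA; apply: IB; apply: ideal_full => //.
have [_ /(_ id id Aid Aid)] : Ind H I id by rewrite IA.
by rewrite (cond_exp_fix H1 HM HV (cstar_id H1)).
Qed.

Lemma sub_IndP I J : ideal B I -> ideal A J ->
  J `<=` Ind H I <-> Coind H J `<=` I.
Proof.
move=> [_ _ _ _ Icl] [JA _ _ Jmul _]; split => [JI|JI].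
  move=> b clb; apply: Icl => e e0; have [_ [j Jj <-] bj] := clb e e0.
  by exists (P j) => //; have [_ /(_ id id Aid Aid)] := JI j Jj.
move=> j Jj; split; first exact: JA.
move=> x y Ax Ay; apply/JI/norm_closure_sub; exists (x \o j \o y) => //.
have [Jxj _] := Jmul x j Ax Jj.
by have [_ ] := Jmul y (x \o j) Ay Jxj.
Qed.

Lemma Coind_mono J K : J `<=` K -> Coind H J `<=` Coind H K.
Proof. by move=> JK; apply: norm_closureS => _ [j /JK Kj <-]; exists j. Qed.

Lemma Ind_mono I K : I `<=` K -> Ind H I `<=` Ind H K.
Proof.
move=> IK b [Ab Ib]; split; first exact: Ab.
by move=> x y Ax Ay; exact: IK _ (Ib x y Ax Ay).
Qed.

Hypothesis Coind_proper : forall J, ideal A J -> J <> A -> Coind H J <> B.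

Lemma maximal_ideal_induced J : maximal_ideal A J ->
  exists2 I, maximal_ideal B I & J = Ind H I.
Proof.
move=> [JI JA Jmax].
have [I Imax JsubI] := maximal_ideal_exists H1 HM (Coind_ideal JI) (Coind_proper JI JA).
have [II IB _] := Imax; exists I => //; apply/esym/Jmax.
- exact: Ind_ideal.
- exact: Ind_proper.
- exact/sub_IndP.
Qed.

(** The usual identity of a Galois connection on the image of one of its maps. *)
Lemma Coind_Ind I : coinduced_ideal H I -> Coind H (Ind H I) = I.
Proof.
move=> [II [J JI IJ]]; have IndI := Ind_ideal II; apply/seteqP; split.
  exact/(sub_IndP II IndI).
by rewrite {1}IJ; apply: Coind_mono; apply/(sub_IndP II JI); rewrite IJ.
Qed.

Lemma Ind_maximal_bij :
  set_bij (maximal_coinduced_ideal R H) (maximal_ideal A) (Ind H).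
Proof.
split.
- move=> I [Ico IB Imax]; have [II _] := Ico; split.
  + exact: Ind_ideal.
  + exact: Ind_proper.
  + move=> K KI KA IK; apply/seteqP; split; last exact: IK.
    have CK := Coind_ideal KI.
    have E : Coind H K = I.
      apply: Imax; [by split => //; exists K|exact: Coind_proper|].
      by rewrite -(Coind_Ind Ico); exact: Coind_mono.
    by apply/(sub_IndP II KI); rewrite E.
- move=> I I' /set_mem[Ico _ _] /set_mem[I'co _ _] E.
  by rewrite -(Coind_Ind Ico) -(Coind_Ind I'co) E.
- move=> J [JI JA Jmax]; have CI := Coind_ideal JI.
  have CB : Coind H J <> B by exact: Coind_proper.
  have IndC : Ind H (Coind H J) = J.
    apply: Jmax; [exact: Ind_ideal|exact: Ind_proper|exact/sub_IndP].
  exists (Coind H J) => //; split.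
  + by split => //; exists J.
  + exact: CB.
  + move=> K Kco KB CK; have [KI [J' J'I KE]] := Kco.
    apply/seteqP; split; last exact: CK.
    have IndK : Ind H K = J.
      apply: Jmax; [exact: Ind_ideal|exact: Ind_proper|].
      by rewrite -{1}IndC; exact: Ind_mono.
    by rewrite -(Coind_Ind Kco) IndK.
Qed.
End Induction.

(** * Compressions and coercive operators *)

Section Compression.
Variables (R : realType) (G : groupType).
Local Notation ell := (ell2 R G).
Local Notation op := (ell -> ell).
Local Notation cut := Defs.cut.
Implicit Types (a b : op) (x y z : ell) (c : R[i]) (S : set G).

Lemma cut_lin S c x y : cut S (c *: x + y) = c *: cut S x + cut S y.
Proof.
apply/val_inj/funext => t /=; rewrite !addfE !scalefE /cut_fun /=.
by case: ifP => _; rewrite ?mulr0 ?addr0.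
Qed.

Lemma cut_setC S x : x = cut S x + cut (~` S) x.
Proof.
apply/val_inj/funext => t /=; rewrite !addfE /cut_fun /= in_setC.
by case: ifP => _ /=; rewrite ?addr0 ?add0r.
Qed.

Lemma normsq_cut S x : normsq x = normsq (cut S x) + normsq (cut (~` S) x).
Proof.
have := @eq_normsq_sum R G [:: (1, x)] [:: (1, cut S x); (1, cut (~` S) x)].
rewrite !sum_listE/=; apply.
- by move=> p; rewrite inE => /eqP ->; exact: ler01.
- by move=> p; rewrite !inE => /orP[] /eqP ->; exact: ler01.
move=> t; rewrite !sum_listE/= /cut_fun in_setC if_neg.
by case: ifP => _; rewrite ComplexField.Normc.normc0 expr0n ?addr0 ?add0r.
Qed.

Lemma ell2_norm_cut S x : ell2_norm (cut S x) <= ell2_norm x.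
Proof.
rewrite -[ell2_norm x]mul1r ell2_norm_le// expr1n mul1r (normsq_cut S x).
by rewrite lerDl normsq_ge0.
Qed.

Lemma cut_lambda_cut S h x : (forall t, S t -> ~ S (h * t)%g) ->
  cut S (lambda h (cut S x)) = 0.
Proof.
move=> Sh; apply/val_inj/funext => t /=; rewrite /cut_fun /=.
case: ifPn => // /set_mem St; case: ifPn => // /set_mem /Sh.
by rewrite mulVKg => /(_ St).
Qed.

Lemma adjoint_exists a : group_algebra setT a ->
  exists2 b, group_algebra setT b & forall x y, dotr (b x) y = dotr x (a y).
Proof.
move=> ga; suff : linear_op a /\ exists2 b, group_algebra setT b &
    forall x y, dotr (b x) y = dotr x (a y) by case.
move: a ga; apply: group_algebra_ind.
  split; first exact: linear_op0.
  exists 0; first exact: group_algebra0.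
  move=> x y; rewrite -[LHS]/(dotr (0 : ell) y) -[RHS]/(dotr x (0 : ell)).
  by rewrite [RHS]dotrC !dotr0l.
move=> c g a _ [la [b gb adj]]; split.
  by apply: linear_opD => //; exact/linear_opZ/linear_lambda.
exists (c^*%C *: lambda g^-1%g + b).
  by apply: group_algebra_lin => //; exact: group_algebra_lambda.
move=> x y; rewrite -[LHS]/(dotr (c^*%C *: lambda g^-1%g x + b x) y).
rewrite -[RHS]/(dotr x (c *: lambda g y + a y)).
rewrite dotrDl dotrZ_adj adj dotr_lambda invgK [RHS]dotrC dotrDl.
by rewrite !(dotrC _ x); congr (dotr x _ + _).
Qed.

(** Expanding, the squared norm of [x - s K x] is at most
    [(1 - s k + s^2 N^2) * normsq x] for any bound [N] of [K]; the choice
    [s = k / (2 N^2)] is the best one, and a bound [N >= k] makes the factor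
    nonnegative. *)
Lemma coercive_near_id (K : op) (k M : R) : 0 < k -> 0 <= M -> op_norm_le K M ->
  (forall x, k * normsq x <= dotr (K x) x) ->
  exists s r : R, r < 1 /\ op_norm_le (id - (s%:C%C *: K)) r.
Proof.
move=> k0 M0 KM coer; pose N := M + k + 1.
have N0 : 0 < N by rewrite /N; lra.
have NM : M <= N by rewrite /N; lra.
have Nk : k <= N by rewrite /N; lra.
(* The factor is [1 - u ^+ 2 / 4]. *)
pose u := k / N.
have u0 : 0 < u by rewrite divr_gt0.
have u1 : u <= 1 by rewrite ler_pdivrMr// mul1r.
pose s := u / (2 * N).
have s0 : 0 <= s by apply: divr_ge0; [exact: ltW|apply: mulr_ge0 => //; exact: ltW].
exists s, (Num.sqrt (1 - u ^+ 2 / 4)).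
have v0 : 0 <= 1 - u ^+ 2 / 4.
  have : u ^+ 2 <= 1 by apply: exprn_ile1 => //; exact: ltW.
  by lra.
split.
  rewrite -[ltRHS]sqrtr1 ltr_sqrt//; have : 0 < u ^+ 2 by rewrite exprn_gt0.
  by lra.
move=> x; rewrite ell2_norm_le ?sqrtr_ge0// sqr_sqrtr//.
rewrite -[(id - _) x]/(x - s%:C%C *: K x) normsqD normsqN dotrC dotrNl dotrZl//.
have nK : normsq (K x) <= N ^+ 2 * normsq x.
  rewrite -(ell2_norm_le _ _ (ltW N0)); apply: le_trans (KM x) _.
  by rewrite ler_wpM2r ?ell2_norm_ge0.
have -> : normsq (s%:C%C *: K x) = s ^+ 2 * normsq (K x).
  by rewrite normsqZ normc_sqr /= expr0n addr0.
have h1 := ler_wpM2l s0 (coer x); have h2 := ler_wpM2l (sqr_ge0 s) nK.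
have e1 : s * (k * normsq x) = u ^+ 2 / 2 * normsq x.
  by rewrite /s /u; field; rewrite gt_eqF.
have e2 : s ^+ 2 * (N ^+ 2 * normsq x) = u ^+ 2 / 4 * normsq x.
  by rewrite /s; field; rewrite gt_eqF.
rewrite e1 in h1; rewrite e2 in h2.
move: h1 h2; set d := s * dotr _ _; set q := s ^+ 2 * _; set n := normsq x => h1 h2.
rewrite mulrBl mul1r; lra.
Qed.

Section Stabilizer.
Variable H : set G.
Hypotheses (H1 : H 1%g) (HM : forall g h, H g -> H h -> H (g * h)%g)
  (HV : forall g, H g -> H g^-1%g).
Local Notation P := (@cond_exp R G H).

(** In the expansion of [a], the terms with [p.2] outside [H] move [S] off itself
    and are killed by the compression; the remaining terms make up [P a]. *)
Lemma compression_cond_exp S (s : seq (R[i] * G)) x :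
  (forall p, p \in s -> ~ H p.2 -> forall t, S t -> ~ S (p.2 * t)%g) ->
  let a : op := \sum_(p <- s) p.1 *: lambda p.2 in
  cut S (a (cut S x)) = cut S (P a (cut S x)).
Proof.
move=> sS a; rewrite /a {a}.
suff [] : cstar_r R setT (\sum_(p <- s) p.1 *: @lambda R G p.2 : op) /\
  cut S ((\sum_(p <- s) p.1 *: @lambda R G p.2 : op) (cut S x)) =
  cut S (P (\sum_(p <- s) p.1 *: @lambda R G p.2 : op) (cut S x)) by [].
elim: s sS => [|p s IH] sS.
  by rewrite big_nil; split; [exact: cstar0|rewrite cond_exp0].
have [Aa Ea] : cstar_r R setT (\sum_(p <- s) p.1 *: @lambda R G p.2 : op) /\
  cut S ((\sum_(p <- s) p.1 *: @lambda R G p.2 : op) (cut S x)) =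
  cut S (P (\sum_(p <- s) p.1 *: @lambda R G p.2 : op) (cut S x)).
  by apply: IH => q qs; apply: sS; rewrite inE qs orbT.
have Al : cstar_r R setT (@lambda R G p.2) by exact: cstar_lambda.
rewrite big_cons; split; first exact (cstar_lin p.1 Al Aa).
rewrite (cond_exp_lin H1 HM HV _ Al Aa).
set b : op := \sum_(p <- s) _ in Ea *.
rewrite -[(p.1 *: lambda p.2 + b) _]/(p.1 *: lambda p.2 (cut S x) + b (cut S x)).
rewrite -[(p.1 *: P _ + P b) _]/(p.1 *: P (lambda p.2) (cut S x) + P b (cut S x)).
rewrite !cut_lin Ea; congr (_ *: _ + _).
rewrite (cond_exp_lambda R H1 HM HV); case: asboolP => // nH.
rewrite cut_lambda_cut; last by apply: sS => //; rewrite inE eqxx.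
by apply/val_inj/funext => t /=; rewrite /cut_fun; case: ifP.
Qed.

(** For [y := cut S x], the vectors [y] and [cut S (P a y) = cut S (a y)] differ by
    at most half the norm of [y], so [ell2_norm y <= 2 * ell2_norm (a y)].
    Replacing [a y] by [a x] costs [N] times the norm of [cut (~` S) x]. *)
Lemma compression_lower_bound S a (N : R) x :
  0 <= N -> linear_op a -> op_norm_le a N ->
  (forall y, cut S (a (cut S y)) = cut S (P a (cut S y))) ->
  op_norm_le (id - P a) (1 / 2) ->
  normsq x <= 8 * normsq (a x) + (8 * N ^+ 2 + 1) * normsq (cut (~` S) x).
Proof.
move=> N0 la aN aS Pa.
set y := cut S x; set z := cut (~` S) x.
have yE : y = cut S y.
  by apply/val_inj/funext => t /=; rewrite /cut_fun /= /cut_fun; case: ifP.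
have half : ell2_norm y <= 2 * ell2_norm (a y).
  have h1 : ell2_norm (cut S ((id - P a) y)) <= 1 / 2 * ell2_norm y.
    exact: le_trans (ell2_norm_cut _ _) (Pa y).
  have E : y = cut S ((id - P a) y) + cut S (a y).
    rewrite {3}yE aS -yE.
    have := cut_lin S 1 ((id - P a) y) (P a y); rewrite !scale1r => <-.
    by rewrite -[(id - P a) y]/(y - P a y) subrK.
  have h2 : ell2_norm y <= ell2_norm (cut S ((id - P a) y)) + ell2_norm (cut S (a y)).
    by rewrite {1}E; exact: ell2_normD.
  by have h3 := ell2_norm_cut S (a y); lra.
have ay : ell2_norm (a y) <= ell2_norm (a x) + N * ell2_norm z.
  have xyz : x = y + z := cut_setC S x.
  have -> : a y = a x - a z by rewrite -(linear_opB x z la) xyz addrK.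
  apply: le_trans (ell2_normD _ _) _; rewrite ell2_normN lerD2l; exact: aN.
have yb : ell2_norm y <= 2 * (ell2_norm (a x) + N * ell2_norm z) by lra.
rewrite (normsq_cut S x) -/y -/z -!ell2_norm_sqr.
have y0 := ell2_norm_ge0 y; have z0 := ell2_norm_ge0 z; have a0 := ell2_norm_ge0 (a x).
move: yb y0 z0 a0; set p := ell2_norm y; set q := ell2_norm z; set r := ell2_norm (a x).
move=> yb y0 z0 a0.
have : p ^+ 2 <= (2 * (r + N * q)) ^+ 2.
  by rewrite ler_sqr ?nnegrE// (le_trans y0).
have : 0 <= (r - N * q) ^+ 2 by exact: sqr_ge0.
have -> : (2 * (r + N * q)) ^+ 2 = 8 * r ^+ 2 + 8 * N ^+ 2 * q ^+ 2 - 4 * (r - N * q) ^+ 2.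
  by ring.
move=> h1 h2; rewrite mulrDl mul1r; lra.
Qed.
End Stabilizer.
End Compression.

(** * Co-induction from a point stabilizer of a boundary *)

Section Boundary.
Variables (R : realType) (G : groupType) (X : ptopologicalType).
Variable act : G -> X -> X.
Hypothesis hX : boundary R act.
Variable x : X.
Local Notation ell := (ell2 R G).
Local Notation op := (ell -> ell).
Local Notation cut := Defs.cut.
Local Notation H := (stabilizer act x).
Local Notation A := (cstar_r R [set: G]).
Local Notation B := (cstar_r R H).
Local Notation P := (@cond_exp R G H).
Implicit Types (xi eta : ell) (a j : op) (J : set op).

Let act1 y : act 1%g y = y. Proof. by case: hX => _ _ []. Qed.
Let actM g k y : act (g * k)%g y = act g (act k y).
Proof. by case: hX => _ _ []. Qed.
Let cact g : continuous (act g). Proof. by case: hX => _ _ []. Qed.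
Let haus : hausdorff_space X. Proof. by case: hX. Qed.

Lemma stabilizer1 : H 1%g. Proof. exact: act1. Qed.

Lemma stabilizerM g k : H g -> H k -> H (g * k)%g.
Proof. by rewrite /stabilizer /= actM => Hg ->. Qed.

Lemma stabilizerV g : H g -> H g^-1%g.
Proof. by rewrite /stabilizer /= => Hg; rewrite -{1}Hg -actM mulVg act1. Qed.

(** An element that moves [x] separates [x] from its image, by Hausdorffness. *)
Lemma displacing_nbhs (s : seq (R[i] * G)) :
  exists U, [/\ open U, U x & forall p, p \in s -> ~ H p.2 ->
    forall y, U y -> ~ U (act p.2 y)].
Proof.
elim: s => [|p s [U [oU Ux sU]]].
  by exists setT; split => //; exact: openT.
have [Hp|nHp] := pselect (H p.2).
  exists U; split => // q; rewrite inE => /orP[/eqP -> //|]; exact: sU.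
have xpx : x != act p.2 x by apply/eqP => E; apply: nHp.
have := haus; rewrite open_hausdorff => /(_ _ _ xpx)[[V W] /=].
move=> [/set_mem Vx /set_mem Wpx] [oV oW /eqP VW].
exists (U `&` V `&` act p.2 @^-1` W); split.
- apply: openI; first exact: openI.
  by apply: open_comp => // y _; exact: cact.
- by split.
- move=> q; rewrite inE => /orP[/eqP ->|qs] nHq y [[Uy Vy] Wy] [[Uqy Vqy] _].
    by have : (V `&` W) (act p.2 y) by []; rewrite VW.
  exact: sU qs nHq y Uy Uqy.
Qed.

Lemma bump_function U : open U -> U x ->
  exists f : X -> R, [/\ continuous f, forall y, 0 <= f y <= 1,
    forall y, ~ U y -> f y = 0 & f x = 1].
Proof.
move=> oU Ux; have cX : compact [set: X] by case: hX.
have cx : closed [set x] by apply: accessible_closed_set1; exact: hausdorff_accessible.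
have [|f [cf f01 f0 f1]] := separate R cX haus (open_closedC oU) cx.
  by rewrite -subset0 => y [nUy /= yx]; apply: nUy; rewrite yx.
by exists f; split => //; exact: f1.
Qed.

(** The conjugate of [cut (~` S)] by [lambda g] restricts to the [t] with [g t x]
    outside [U].  Hence the left-hand side is the squared norm of [xi] with
    weight at [t] the sum of the [p.1] for which [p.2] takes [t x] outside [U],
    and the hypothesis at [t x] bounds this weight. *)
Lemma average_displacement (s : seq (R * G)) (f : X -> R) U (d : R) xi :
  (forall p, p \in s -> 0 <= p.1) -> 0 <= d ->
  (forall y, f y <= 1) -> (forall y, ~ U y -> f y <= 0) ->
  (forall y, 0 < \sum_(p <- s) p.1 * (f (act p.2 y) - (1 - d))) ->
  \sum_(p <- s) p.1 * normsq (cut (~` [set t | U (act t x)]) (lambda p.2 xi)) <=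
  d * (\sum_(p <- s) p.1) * normsq xi.
Proof.
move=> s0 d0 f1 fU sf; set S := [set t | U (act t x)].
pose W := \sum_(p <- s) p.1.
have W0 : 0 <= W by rewrite /W big_seq sumr_ge0.
pose F (p : R * G) : ell := lambda p.2^-1%g (cut (~` S) (lambda p.2 xi)).
have := @le_normsq_sum R G [seq (p.1, F p) | p <- s] [:: (d * W, xi)].
rewrite !sum_listE /= big_map /=.
under eq_bigr => p _ do rewrite /F normsq_lambda.
apply.
- by move=> _ /mapP[p /s0 ps ->].
- by move=> p; rewrite inE => /eqP -> /=; rewrite mulr_ge0.
move=> t; rewrite !sum_listE big_map.
set n := ComplexField.Normc.normc _ ^+ 2.
have n0 : 0 <= n by exact: sqr_ge0.
rewrite (_ : d * W * n = (\sum_(p <- s) p.1 * d) * n); last first.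
  by rewrite -mulr_suml (mulrC d).
have := sf (act t x); move: (n0).
rewrite le_eqVlt => /predU1P[n00 _|n1 H].
  rewrite -n00 mulr0 big_seq; apply: sumr_le0 => p ps.
  rewrite -(mulr0 p.1) ler_wpM2l ?s0//= /cut_fun invgK mulKg; case: ifP => _.
    by rewrite -[X in X <= _]/n -n00.
  by rewrite ComplexField.Normc.normc0 expr0n.
rewrite mulr_suml.
apply: (@le_trans _ _ (\sum_(p <- s) p.1 * (1 - f (act p.2 (act t x))) * n)).
  rewrite big_seq [leRHS]big_seq; apply: ler_sum => p ps.
  rewrite -mulrA ler_wpM2l ?s0//= /cut_fun invgK mulKg -actM.
  case: ifPn => [/set_mem nS|_].
    by rewrite -[X in X <= _]/n ler_peMl//; have := fU _ nS; lra.
  rewrite ComplexField.Normc.normc0 expr0n mulr_ge0//.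
  by have := f1 (act (p.2 * t)%g x); lra.
rewrite -!mulr_suml ler_wpM2r// mulr_suml -subr_ge0 -sumrB.
apply: ltW; apply: lt_le_trans H _; apply: ler_sum => p _; lra.
Qed.

(** Coercivity of [K]: with [eta := lambda p.2 xi], the term of index [p] in
    [dotr (K xi) xi] is [p.1 * dotr (j eta) (a eta)], and polarization gives
    [dotr (j eta) (a eta) >= normsq (a eta) - normsq (j eta - a eta)].  The first
    summand is controlled by [compression_lower_bound], the second one by the
    distance of [j] from [a]; the loss from vectors supported away from [S] is
    small on average by [average_displacement].  The bound [d] is chosen after
    [a], since it has to beat the norm of [a]. *)
Lemma Coind_proper J : ideal A J -> J <> A -> Coind H J <> B.
Proof.
move=> JI JA CB; apply: JA.
have H1 := stabilizer1; have HM := stabilizerM; have HV := stabilizerV.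
have [subJA J0 Jlin Jmul Jcl] := JI.
(* 1 / 8 twice keeps [P a] within 1 / 2 of the identity, and its square loses
   only 1 / 64 out of the 1 / 8 gained from [compression_lower_bound]. *)
have e0 : 0 < 1 / 8 :> R by lra.
have : Coind H J id by rewrite CB; exact: cstar_id.
move=> /(_ _ e0)[_ [j Jj <-] Pj]; have Aj := subJA j Jj.
have [a ga ja] := Aj _ e0; have Aa := group_algebra_cstar ga.
have Pa : op_norm_le (id - P a) (1 / 2).
  have Aja : A (j - a) by rewrite addrC -scaleN1r; exact: cstar_lin.
  have PjPa : op_norm_le (P j - P a) (1 / 8).
    by rewrite -(cond_expB H1 HM HV Aj Aa); exact: (cond_exp_norm H1 HM HV Aja ja).
  by apply: op_norm_leW (op_norm_le_trans Pj PjPa); lra.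
have [N N0 aN] := cstar_norm_le Aa.
have la := group_algebra_linear_op ga.
have [a' ga' adj] := adjoint_exists ga.
pose C := 8 * N ^+ 2 + 1; have C1 : 1 <= C.
  by rewrite lerDr mulr_ge0 ?sqr_ge0.
pose d := (2 * C)^-1.
have d0 : 0 < d by rewrite invr_gt0; lra.
have Cd : C * d = 1 / 2 by rewrite /d; field; rewrite gt_eqF//; lra.
have [s _ aE] := group_algebraP ga.
have [U [oU Ux sU]] := displacing_nbhs s.
have [f [cf f01 f0 fx]] := bump_function oU Ux.
have fx1 : 1 - d < f x by rewrite fx; lra.
have [w w0 wf] := covering_combination hX cf f01 fx1.
pose W := \sum_(p <- w) p.1.
pose S := [set t | U (act t x)].
have disp xi : \sum_(p <- w) p.1 * normsq (cut (~` S) (lambda p.2 xi)) <= d * W * normsq xi.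
  apply: (@average_displacement _ f) => //; first exact: ltW.
    by move=> y; case/andP: (f01 y).
  by move=> y /f0 ->.
have W0 : 0 < W.
  apply: lt_le_trans (_ : d^-1 * \sum_(p <- w) p.1 * (f (act p.2 x) - (1 - d)) <= _).
    by apply: mulr_gt0; [rewrite invr_gt0|exact: wf].
  rewrite mulrC ler_pdivrMr//.
  rewrite big_seq /W mulr_suml [leRHS]big_seq; apply: ler_sum => p pw.
  by rewrite ler_wpM2l ?w0//; case/andP: (f01 (act p.2 x)) => _; lra.
have aS y : cut S (a (cut S y)) = cut S (P a (cut S y)).
  rewrite {1 2}aE; apply: compression_cond_exp => // q qs nHq t St.
  by rewrite /S /= actM; exact: sU.
pose T (p : R * G) : op := lambda p.2^-1%g \o (a' \o (j \o lambda p.2)).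
pose K : op := \sum_(p <- w) p.1%:C%C *: T p.
have JT p : J (T p).
  have Al g : A (lambda g) by exact: cstar_lambda.
  have [_ h1] := Jmul _ _ (Al p.2) Jj.
  have [h2 _] := Jmul _ _ (group_algebra_cstar ga') h1.
  by have [h3 _] := Jmul _ _ (Al p.2^-1%g) h2.
have JK : J K.
  rewrite /K; elim: (w) => [|p v IH]; first by rewrite big_nil.
  by rewrite big_cons; exact: Jlin (JT p) IH.
have KE xi : dotr (K xi) xi =
    \sum_(p <- w) p.1 * dotr (j (lambda p.2 xi)) (a (lambda p.2 xi)).
  have -> : K xi = \sum_(p <- w) p.1%:C%C *: T p xi.
    by rewrite /K; elim: (w) => [|p v IH]; rewrite ?big_nil// !big_cons -IH.
  rewrite dotr_sum big_seq [RHS]big_seq; apply: eq_bigr => p pw.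
  rewrite dotrZl ?w0//; congr (_ * _).
  by rewrite /T /= dotr_lambda invgK adj.
have coer xi : W / 32 * normsq xi <= dotr (K xi) xi.
  rewrite KE.
  apply: (@le_trans _ _ (\sum_(p <- w) p.1 * (normsq xi / 16 * (3 / 2) -
    C / 8 * normsq (cut (~` S) (lambda p.2 xi))))).
    rewrite (eq_bigr (fun p : R * G => p.1 * (normsq xi / 16 * (3 / 2)) -
      C / 8 * (p.1 * normsq (cut (~` S) (lambda p.2 xi))))); last first.
      by move=> p _; ring.
    rewrite sumrB -mulr_suml -mulr_sumr -/W.
    have := ler_wpM2l (_ : 0 <= C / 8) (disp xi).
    have -> : C / 8 * (d * W * normsq xi) = W * normsq xi / 16.
      transitivity ((C * d) * (W * normsq xi) / 8); first by ring.
      by rewrite Cd; field.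
    lra.
  rewrite big_seq [leRHS]big_seq; apply: ler_sum => p pw; rewrite ler_wpM2l ?w0//.
  set eta := lambda p.2 xi; rewrite -(normsq_lambda p.2 xi) -/eta.
  have low : normsq eta <= 8 * normsq (a eta) + C * normsq (cut (~` S) eta).
    exact: (compression_lower_bound _ N0 la aN aS Pa).
  have near_a : normsq (j eta - a eta) <= (1 / 8) ^+ 2 * normsq eta.
    by rewrite -(ell2_norm_le _ _ (ltW e0)); exact: ja.
  have := normsqD (j eta) (- a eta).
  rewrite normsqN dotrC dotrNl (dotrC (a eta)).
  move: near_a low.
  have := normsq_ge0 (j eta); have := normsq_ge0 eta.
  have -> : (1 / 8) ^+ 2 = 1 / 64 :> R by field.
  lra.
have [M M0 KM] := cstar_norm_le (subJA K JK).
have W32 : 0 < W / 32 by lra.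
have [t [r [r1 tr]]] := coercive_near_id W32 M0 KM coer.
apply: (@ideal_neumann R G setT _ _ J (t%:C%C *: K) r) => //.
by rewrite -[_ *: _]addr0; exact: Jlin.
Qed.
End Boundary.

Theorem theorem1p2 (R : realType) (G : groupType) (X : ptopologicalType)
    (act : G -> X -> X) (hX : furstenberg_boundary R act) (x : X) :
  (forall J, maximal_ideal (cstar_r R [set: G]) J ->
     exists2 I, maximal_ideal (cstar_r R (stabilizer act x)) I &
       J = Ind (stabilizer act x) I) /\
  set_bij (maximal_coinduced_ideal R (stabilizer act x))
          (maximal_ideal (cstar_r R [set: G]))
          (Ind (stabilizer act x)).
Proof.
have [bX _] := hX.
have H1 := stabilizer1 bX x; have HM := @stabilizerM _ _ _ _ bX x.
have HV := @stabilizerV _ _ _ _ bX x.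
have proper := @Coind_proper _ _ _ _ bX x.
split; first by move=> J; exact: maximal_ideal_induced.
exact: Ind_maximal_bij.
Qed.
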